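(* Let $S=\Bbbk[x_1,\dots,x_n]$ be a polynomial ring over a field $\Bbbk$, let $M$ be a squarefree $S$-module of dimension $d$, let $i$ be an integer with $0\le i<d$, and let $l$ be a positive integer. If $M$ is $l$-Cohen-Macaulay, then $M^{\langle i\rangle}$ is $(l+d-i)$-Cohen-Macaulay (unless $M^{\langle i\rangle}=0$).
   Context: $S$ is regarded as a $\mathbb Z^n$-graded ring, $[n]=\{1,\dots,n\}$, $\mathbb N=\{0,1,2,\dots\}$. For $\mathbf a=(a_1,\dots,a_n)\in\mathbb N^n$ set $\operatorname{supp}(\mathbf a)=\{i\mid a_i\ne0\}$ and $x^{\mathbf a}=\prod x_i^{a_i}$. A $\mathbb Z^n$-graded $S$-module $M$ is squarefree if it is finitely generated, $\mathbb N^n$-graded (i.e. $M=\bigoplus_{\mathbf a\in\mathbb N^n}M_{\mathbf a}$), and for all $\mathbf a,\mathbf b\in\mathbb N^n$ with $\operatorname{supp}(\mathbf a)\supset\operatorname{supp}(\mathbf b)$ the multiplication map $M_{\mathbf a}\to M_{\mathbf a+\mathbf b}$, $y\mapsto x^{\mathbf b}y$, is bijective. For $W\subset[n]$ put $S|_W=\Bbbk[x_i\mid i\in W]$ and $M|_W=\bigoplus_{\mathbf a\in\mathbb N^n,\ \operatorname{supp}(\mathbf a)\subset W}M_{\mathbf a}$, a squarefree $S|_W$-module; put $M|_{-W}=M|_{[n]\setminus W}$. For a positive integer $l$, a squarefree module $M$ is $l$-Cohen-Macaulay if for each $W\subset[n]$ with $\#W<l$, $M|_{-W}$ is either the zero module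 or a Cohen-Macaulay module (over $S|_{[n]\setminus W}$) with $\dim M|_{-W}=\dim M$. For $0\le i<d=\dim M$, $M^{>i}:=\bigoplus_{\mathbf a\in\mathbb N^n,\ \#\operatorname{supp}(\mathbf a)>i}M_{\mathbf a}$ is a squarefree submodule of $M$, and $M^{\langle i\rangle}:=M/M^{>i}$, which is again squarefree. *)

(* Defs.v *)
From HB Require Import structures.
From mathcomp Require Import all_boot all_order all_algebra.
From mathcomp Require Import ring_quotient generic_quotient mpoly.
From mathcomp Require Import boolp classical_sets functions.

Set Implicit Arguments.
Unset Strict Implicit.
Unset Printing Implicit Defensive.

Import Order.TTheory GRing.Theory Num.Theory.

Local Open Scope ring_scope.

Section CohenMacaulay.
Variables (K : fieldType) (n : nat) (M : lmodType {mpoly K[n]}).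

Definition zero_module : Prop := forall x : M, x = 0.

Definition annihilator (p : {mpoly K[n]}) : Prop := forall x : M, p *: x = 0.

(* [P] is a prime of the closed subset V(Ann M) of Spec; properness is part of
   [idealr_closed]. *)
Definition supp_prime (P : {pred {mpoly K[n]}}) : Prop :=
  [/\ idealr_closed P, prime_idealr_closed P
    & forall p, annihilator p -> p \in P].

Definition supp_prime_chain (m : nat) (P : nat -> {pred {mpoly K[n]}}) : Prop :=
  (forall j, (j <= m)%N -> supp_prime (P j)) /\
  (forall j, (j < m)%N ->
     {subset P j <= P j.+1} /\ ~ {subset P j.+1 <= P j}).

(* The zero module has no dimension (its dimension is -oo by convention). *)
Definition has_dim (d : nat) : Prop :=
  (exists P, supp_prime_chain d P) /\
  (forall m P, supp_prime_chain m P -> (m <= d)%N).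

Definition ideal_mul (s : seq {mpoly K[n]}) : set M :=
  [set x | exists y : 'I_(size s) -> M, x = \sum_(j < size s) s`_j *: y j]%classic.

Definition regular_seq (s : seq {mpoly K[n]}) : Prop :=
  (forall j, (j < size s)%N -> forall x : M,
     ideal_mul (take j s) (s`_j *: x) -> ideal_mul (take j s) x) /\
  (exists x : M, ~ ideal_mul s x).

(* membership in (x_1, ..., x_n), i.e. vanishing of the constant coefficient *)
Definition irrelevant (p : {mpoly K[n]}) : bool := p@_0%MM == 0.

(* Depth is taken with respect to the graded maximal ideal, as usual for graded
   modules; the sequences need not be homogeneous. *)
Definition has_depth (t : nat) : Prop :=
  (exists s, [/\ all irrelevant s, regular_seq s & size s = t]) /\
  (forall s, all irrelevant s -> regular_seq s -> (size s <= t)%N).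

Definition CohenMacaulay : Prop := exists d, has_dim d /\ has_depth d.

Definition finitely_generated : Prop :=
  exists s : seq M, forall x : M,
    exists p : 'I_(size s) -> {mpoly K[n]}, x = \sum_(j < size s) p j *: s`_j.

End CohenMacaulay.

Notation Zdeg n := {ffun 'I_n -> int}.

Definition deg_of_mnm n (m : 'X_{1..n}) : Zdeg n := [ffun i => (m i)%:Z].

Definition nneg_deg n (a : Zdeg n) : Prop := forall i, 0 <= a i.

Definition supp n (a : Zdeg n) : {set 'I_n} := [set i | a i != 0]%SET.

Definition span_of (V : zmodType) (I : Type) (C : I -> set V) (D : set I) : set V :=
  [set x | exists2 s : seq V, (forall z, z \in s -> exists2 a, D a & C a z)
                            & x = \sum_(z <- s) z]%classic.

Record gradedModule (K : fieldType) (n : nat) := GradedModule {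
  gm_car :> lmodType {mpoly K[n]};
  component : Zdeg n -> set gm_car;
  component0 : forall a, component a 0;
  componentP : forall a (c : K) x y,
    component a x -> component a y -> component a (c%:MP *: x + y);
  component_mul : forall a m x,
    component a x -> component (a + deg_of_mnm m) ('X_[m] *: x);
  component_sum : forall x, span_of component setT x;
  component_indep : forall (s : seq (Zdeg n)) (f : Zdeg n -> gm_car),
    uniq s -> (forall a, component a (f a)) -> \sum_(a <- s) f a = 0 ->
    forall a, a \in s -> f a = 0
}.

Arguments component {K n} g a.

Definition squarefree (K : fieldType) (n : nat) (M : gradedModule K n) : Prop :=
  [/\ finitely_generated M,
      forall x : M, span_of (component M) (@nneg_deg n) x
    & forall a b : 'X_{1..n},
        supp (deg_of_mnm b) \subset supp (deg_of_mnm a) ->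
        set_bij (component M (deg_of_mnm a))
                (component M (deg_of_mnm (a + b)%MM))
                (fun y => 'X_[b] *: y)].

Section GradedTheory.
Variables (K : fieldType) (n : nat) (M : gradedModule K n).
Implicit Types (D : set (Zdeg n)).

Local Notation span := (span_of (component M)).

Lemma span0 D : span D 0.
Proof. by exists [::]; rewrite ?big_nil. Qed.

Lemma spanD D x y : span D x -> span D y -> span D (x + y).
Proof.
move=> [s sD ->] [t tD ->]; exists (s ++ t); last by rewrite big_cat.
by move=> z; rewrite mem_cat => /orP[/sD|/tD].
Qed.

Lemma span_component D a x : D a -> component M a x -> span D x.
Proof.
move=> Da ax; exists [:: x]; last by rewrite big_seq1.
by move=> z; rewrite inE => /eqP ->; exists a.
Qed.

Lemma span_ind D (P : M -> Prop) :
  P 0 -> (forall x y, P x -> P y -> P (x + y)) ->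
  (forall a x, D a -> component M a x -> P x) -> forall x, span D x -> P x.
Proof.
move=> P0 PD PC x [s sD ->]; rewrite big_seq; elim/big_ind: _ => // z.
by move=> /sD[a Da az]; apply: PC az.
Qed.

Lemma componentZ a (c : K) x : component M a x -> component M a (c%:MP *: x).
Proof.
by move=> ax; rewrite -[_ *: x]addr0; apply: componentP => //; apply: component0.
Qed.

Lemma componentN a x : component M a x -> component M a (- x).
Proof. by move=> /(componentZ (-1)); rewrite mpolyCN scaleN1r. Qed.

Lemma componentB a x y :
  component M a x -> component M a y -> component M a (x - y).
Proof.
move=> ax /componentN ay; rewrite -[x]scale1r -mpolyC1.
exact: componentP.
Qed.

Lemma spanZ D (q : {mpoly K[n]}) x :
  (forall a m, m \in msupp q -> D a -> D (a + deg_of_mnm m)) ->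
  span D x -> span D (q *: x).
Proof.
move=> DA; move: x; apply: span_ind.
- by rewrite scaler0; apply: span0.
- by move=> x y Dx Dy; rewrite scalerDr; apply: spanD.
move=> a x Da ax; rewrite [q in q *: _]mpolyE scaler_suml big_seq.
elim/big_ind: _ => [|y z|m mq]; [exact: span0|exact: spanD|].
apply: (span_component (a := a + deg_of_mnm m)); first exact: DA.
by rewrite -mul_mpolyC -scalerA; apply/componentZ/component_mul.
Qed.

Lemma spanN D x : span D x -> span D (- x).
Proof.
move: x; apply: span_ind.
- by rewrite oppr0; apply: span0.
- by move=> x y Dx Dy; rewrite opprD; apply: spanD.
- by move=> a x Da /componentN; apply: span_component.
Qed.

Lemma span_outside D (s : seq (Zdeg n)) (f : Zdeg n -> M) :
  uniq s -> (forall a, component M a (f a)) -> span D (\sum_(a <- s) f a) ->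
  forall a, a \in s -> ~ D a -> f a = 0.
Proof.
move=> us fC [t]; elim: t s f us fC => [|z t IH] s f us fC tD.
  by rewrite big_nil => f0 a sa _; apply: component_indep f0 _ sa.
have [b Db bz] := tD z (mem_head _ _).
pose g c := (if c \in s then f c else 0) - (if c == b then z else 0).
have gC c : component M c (g c).
  apply: componentB; first by case: ifP => // _; apply: component0.
  by case: eqP => [->|_] //; apply: component0.
rewrite big_cons => fE a sa nDa.
have ab : a != b by apply/eqP => ab; apply: nDa; rewrite ab.
suff : g a = 0 by rewrite /g sa (negPf ab) subr0.
apply: (IH (undup (b :: s))) => //; first exact: undup_uniq.
- by move=> y yt; apply: tD; rewrite inE yt orbT.
- rewrite /g sumrB -big_mkcond /= -big_filter.
  have -> : \sum_(c <- [seq c <- undup (b :: s) | c \in s]) f c = \sum_(c <- s) f c.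
    apply: perm_big; apply: uniq_perm; rewrite ?filter_uniq ?undup_uniq // => c.
    by rewrite mem_filter mem_undup inE; case: (c \in s); rewrite ?orbT.
  have -> : \sum_(c <- undup (b :: s)) (if c == b then z else 0) = z.
    rewrite (bigD1_seq b) ?undup_uniq ?mem_undup ?mem_head //= eqxx.
    by rewrite big1 ?addr0 // => c /negPf ->.
  by rewrite fE addrC addKr.
- by rewrite mem_undup inE sa orbT.
Qed.

End GradedTheory.

Lemma deg_of_mnm_ge0 n (m : 'X_{1..n}) i : 0 <= deg_of_mnm m i.
Proof. by rewrite ffunE. Qed.

Lemma nneg_degD n (a : Zdeg n) m : nneg_deg a -> nneg_deg (a + deg_of_mnm m).
Proof. by move=> a0 i; rewrite ffunE addr_ge0 // deg_of_mnm_ge0. Qed.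

Lemma suppD n (a : Zdeg n) m :
  nneg_deg a -> supp (a + deg_of_mnm m) = (supp a :|: supp (deg_of_mnm m))%SET.
Proof.
move=> a0; apply/finset.setP => i; rewrite !inE ffunE paddr_eq0 ?deg_of_mnm_ge0 //.
by rewrite negb_and.
Qed.

(* S|_W is the polynomial ring in #|W| variables; [enum_val] is the increasing
   bijection from 'I_#|W| onto W, and [mpoly_incl W] the inclusion S|_W -> S. *)
Definition mpoly_incl (K : fieldType) (n : nat) (W : {set 'I_n})
    (p : {mpoly K[#|W|]}) : {mpoly K[n]} :=
  p \mPo [tuple 'X_(enum_val j) | j < #|W|].

Section Restriction.
Variables (K : fieldType) (n : nat) (M : gradedModule K n) (W : {set 'I_n}).

Definition restr_deg : set (Zdeg n) :=
  [set a | nneg_deg a /\ supp a \subset W]%classic.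

Definition restr_pred : {pred M} :=
  fun x => `[< span_of (component M) restr_deg x >].

Lemma restr_zmod_closed : zmod_closed restr_pred.
Proof.
split=> [|x y]; rewrite !unfold_in; first by apply/asboolP; apply: span0.
move=> /asboolP xW /asboolP yW; apply/asboolP.
by apply: spanD => //; apply: spanN.
Qed.

HB.instance Definition _ := GRing.isZmodClosed.Build M restr_pred restr_zmod_closed.

Record restr := Restr { restr_val : M; restr_valP : restr_val \in restr_pred }.

HB.instance Definition _ := [isSub for restr_val].
HB.instance Definition _ := [Choice of restr by <:].
HB.instance Definition _ := [SubChoice_isSubZmodule of restr by <:].

Lemma msupp_mpoly_incl (p : {mpoly K[#|W|]}) m :
  m \in msupp (mpoly_incl p) -> supp (deg_of_mnm m) \subset W.
Proof.
move=> mp; apply/fintype.subsetP => i; rewrite inE ffunE; apply: contraR => iW.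
suff : m \in [pred m : 'X_{1..n} | m i == 0%N] by [].
move: m mp; rewrite /mpoly_incl comp_mpolyE.
elim/big_ind: _ => [m|q r IHq IHr m|k _ m].
- by rewrite msupp0.
- by move=> /msuppD_le; rewrite mem_cat => /orP[/IHq|/IHr].
move=> /msuppZ_le; elim/big_ind: _ m => [m|q r IHq IHr m|j _ m].
- by rewrite msupp1 inE => /eqP ->; rewrite inE mnm0E.
- move=> /msuppM_le/allpairsP[[m1 m2] /= [/IHq m1i /IHr m2i ->]].
  by move: m1i m2i; rewrite !inE mnmDE => /eqP -> /eqP ->.
rewrite tnth_mktuple mpolyXn msuppX inE => /eqP ->.
have /negPf ji : enum_val j != i by apply: contraNneq iW => <-; apply: enum_valP.
by rewrite inE mulmnE mnm1E ji.
Qed.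

Lemma restr_scale_subproof (p : {mpoly K[#|W|]}) (x : restr) :
  mpoly_incl p *: restr_val x \in restr_pred.
Proof.
have := restr_valP x; rewrite !unfold_in => /asboolP xW; apply/asboolP.
apply: spanZ xW => a m /msupp_mpoly_incl mW [a0 aW]; split.
  exact: nneg_degD.
by rewrite suppD // finset.subUset aW.
Qed.

Definition restr_scale (p : {mpoly K[#|W|]}) (x : restr) : restr :=
  Restr (restr_scale_subproof p x).

Lemma restr_scaleA p q x :
  restr_scale p (restr_scale q x) = restr_scale (p * q) x.
Proof. by apply: val_inj; rewrite /= scalerA /mpoly_incl -rmorphM. Qed.

Lemma restr_scale1 : left_id 1 restr_scale.
Proof. by move=> x; apply: val_inj; rewrite /= /mpoly_incl rmorph1 scale1r. Qed.

Lemma restr_scaleDr : right_distributive restr_scale +%R.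
Proof. by move=> p x y; apply: val_inj; rewrite /= scalerDr. Qed.

Lemma restr_scaleDl x : {morph restr_scale^~ x : p q / p + q}.
Proof.
by move=> p q; apply: val_inj; rewrite /= /mpoly_incl rmorphD scalerDl.
Qed.

HB.instance Definition _ := GRing.Zmodule_isLmodule.Build {mpoly K[#|W|]} restr
  restr_scaleA restr_scale1 restr_scaleDr restr_scaleDl.

End Restriction.

Section Skeleton.
Variables (K : fieldType) (n : nat) (M : gradedModule K n) (i : nat).

Definition above_deg : set (Zdeg n) :=
  [set a | nneg_deg a /\ (i < #|supp a|)%N]%classic.

Definition above : {pred M} :=
  fun x => `[< span_of (component M) above_deg x >].

Lemma above_zmod_closed : zmod_closed above.
Proof.
split=> [|x y]; rewrite !unfold_in; first by apply/asboolP; apply: span0.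
move=> /asboolP xW /asboolP yW; apply/asboolP.
by apply: spanD => //; apply: spanN.
Qed.

HB.instance Definition _ := GRing.isZmodClosed.Build M above above_zmod_closed.

Lemma aboveZ (p : {mpoly K[n]}) x : x \in above -> p *: x \in above.
Proof.
rewrite !unfold_in => /asboolP xi; apply/asboolP.
apply: spanZ xi => a m _ [a0 ai]; split; first exact: nneg_degD.
rewrite suppD //; apply: leq_trans ai _.
by apply/subset_leq_card/finset.subsetUl.
Qed.

Definition skel : Type := Quotient.quot above.

HB.instance Definition _ := GRing.Zmodule.on skel.
HB.instance Definition _ := ZmodQuotient.on skel.

Local Open Scope quotient_scope.

Definition skel_scale (p : {mpoly K[n]}) (u : skel) : skel :=
  \pi_skel (p *: repr u).

Lemma skel_scale_pi p x : skel_scale p (\pi_skel x) = \pi_skel (p *: x).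
Proof.
apply/eqP; rewrite /skel_scale -[_ == _]Quotient.idealrBE -scalerBr.
by apply: aboveZ; rewrite Quotient.idealrBE reprK.
Qed.

Lemma skel_scaleA p q u :
  skel_scale p (skel_scale q u) = skel_scale (p * q) u.
Proof. by rewrite [skel_scale q u]/skel_scale skel_scale_pi scalerA. Qed.

Lemma skel_scale1 : left_id 1 skel_scale.
Proof. by move=> u; rewrite /skel_scale scale1r reprK. Qed.

Lemma skel_scaleDr : right_distributive skel_scale +%R.
Proof.
move=> p u v; rewrite -{1}[u]reprK -{1}[v]reprK -raddfD skel_scale_pi.
by rewrite scalerDr raddfD.
Qed.

Lemma skel_scaleDl u : {morph skel_scale^~ u : p q / p + q}.
Proof. by move=> p q; rewrite /skel_scale scalerDl raddfD. Qed.

HB.instance Definition _ := GRing.Zmodule_isLmodule.Build {mpoly K[n]} skel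
  skel_scaleA skel_scale1 skel_scaleDr skel_scaleDl.

Definition skel_component (a : Zdeg n) : set skel :=
  [set \pi_skel x | x in component M a]%classic.

Lemma skel_component0 a : skel_component a 0.
Proof. by exists 0; [exact: component0|rewrite raddf0]. Qed.

Lemma skel_componentP a (c : K) u v :
  skel_component a u -> skel_component a v -> skel_component a (c%:MP *: u + v).
Proof.
move=> [x ax <-] [y ay <-]; exists (c%:MP *: x + y); first exact: componentP.
by rewrite raddfD /=; congr (_ + _); apply/esym/skel_scale_pi.
Qed.

Lemma skel_component_mul a m u :
  skel_component a u -> skel_component (a + deg_of_mnm m) ('X_[m] *: u).
Proof.
move=> [x ax <-]; exists ('X_[m] *: x); first exact: component_mul.
exact/esym/skel_scale_pi.
Qed.

Lemma skel_component_sum u : span_of skel_component setT u.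
Proof.
have [s sC rE] := component_sum (repr u).
exists [seq \pi_skel x | x <- s]; last first.
  by rewrite -[LHS]reprK rE raddf_sum big_map.
by move=> _ /mapP[x /sC[a _ ax] ->]; exists a => //; exists x.
Qed.

Lemma skel_component_indep (s : seq (Zdeg n)) (f : Zdeg n -> skel) :
  uniq s -> (forall a, skel_component a (f a)) -> \sum_(a <- s) f a = 0 ->
  forall a, a \in s -> f a = 0.
Proof.
move=> us fC f0 a sa.
have /choice[g gP] : forall b, exists x, component M b x /\ \pi_skel x = f b.
  by move=> b; have [x bx <-] := fC b; exists x.
have fE : f = (fun b => \pi_skel (g b)) by apply/funext => b; case: (gP b).
have : \sum_(b <- s) g b \in above.
  rewrite -[X in X \in _]subr0 Quotient.idealrBE raddf0 raddf_sum.
  by rewrite -[X in _ == X]f0 fE.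
rewrite unfold_in => /asboolP gi.
have [ai|ai] := pselect (above_deg a); last first.
  rewrite fE (span_outside us _ gi sa ai) ?raddf0 // => b.
  by case: (gP b).
rewrite fE -[RHS](raddf0 \pi_skel); apply/eqP.
rewrite -[_ == _]Quotient.idealrBE subr0 unfold_in; apply/asboolP.
by apply: span_component ai _; case: (gP a).
Qed.

Definition skeleton : gradedModule K n :=
  GradedModule skel_component0 skel_componentP skel_component_mul
    skel_component_sum skel_component_indep.

End Skeleton.

Lemma skeleton_squarefree (K : fieldType) (n : nat) (M : gradedModule K n) i :
  squarefree M -> squarefree (skeleton M i).
Proof.
move=> [[s sG] MN Mbij]; split.
- exists [seq \pi_(skel M i)%qT x | x <- s] => u; rewrite size_map.
  have [p pE] := sG (repr u); exists p.
  rewrite -[LHS]reprK pE raddf_sum; apply: eq_bigr => j _.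
  by rewrite (nth_map 0) //; apply/esym/skel_scale_pi.
- move=> u; have [t tN tE] := MN (repr u).
  exists [seq \pi_(skel M i)%qT x | x <- t]; last first.
    by rewrite -[LHS]reprK tE raddf_sum big_map.
  by move=> _ /mapP[x /tN[a a0 ax] ->]; exists a => //; exists x.
move=> a b ba; have [bf bi bs] := Mbij a b ba.
have dD : deg_of_mnm (a + b)%MM = deg_of_mnm a + deg_of_mnm b.
  by apply/ffunP => j; rewrite !ffunE mnmDE PoszD.
have sD : supp (deg_of_mnm (a + b)%MM) = supp (deg_of_mnm a).
  rewrite dD suppD; last exact: deg_of_mnm_ge0.
  by apply/finset.setUidPl.
have piZ (x : M) : 'X_[b] *: (\pi_(skel M i)%qT x : skeleton M i) =
    \pi_(skel M i)%qT ('X_[b] *: x) by exact: skel_scale_pi.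
have pi0 (x : M) (c : 'X_{1..n}) : (i < #|supp (deg_of_mnm c)|)%N ->
    component M (deg_of_mnm c) x -> \pi_(skel M i)%qT x = 0.
  move=> ic cx; rewrite -[RHS](raddf0 \pi_(skel M i)%qT); apply/eqP.
  rewrite -[_ == _]Quotient.idealrBE subr0 unfold_in; apply/asboolP.
  by apply: span_component cx; split=> // j; apply: deg_of_mnm_ge0.
split.
- move=> _ [x ax <-]; exists ('X_[b] *: x); first exact: bf.
  by symmetry; apply: piZ.
- move=> u v /set_mem[x ax <-] /set_mem[y ay <-] /=; rewrite !piZ.
  have [ia|ia] := ltnP i #|supp (deg_of_mnm a)|; first by rewrite (pi0 x a) // (pi0 y a).
  move=> /eqP; rewrite -[_ == _]Quotient.idealrBE unfold_in => /asboolP xy.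
  congr (\pi_(skel M i)%qT _); apply: bi; rewrite ?in_setE //.
  apply/eqP; rewrite -subr_eq0; apply/eqP; rewrite /=.
  pose c := deg_of_mnm (a + b)%MM.
  pose f e := if e == c then 'X_[b] *: x - 'X_[b] *: y else 0.
  have fc : f c = 'X_[b] *: x - 'X_[b] *: y by rewrite /f eqxx.
  rewrite -fc; apply: (span_outside (D := @above_deg n i) (s := [:: c])) => //.
  + move=> e; rewrite /f; case: eqP => [->|_]; last exact: component0.
    by apply: componentB; apply: bf.
  + by rewrite big_seq1 fc.
  + exact: mem_head.
  + by move=> [_]; rewrite sD ltnNge ia.
- move=> _ [z abz <-]; have [x ax xE] := bs _ abz.
  exists (\pi_(skel M i)%qT x); first by exists x.
  by rewrite /= piZ xE.
Qed.

Definition higher_CohenMacaulay (K : fieldType) (n : nat) (l : nat)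
    (M : gradedModule K n) : Prop :=
  forall W : {set 'I_n}, (#|W| < l)%N ->
    let N := restr M (~: W)%SET in
    zero_module N \/
    (CohenMacaulay N /\ exists d, has_dim N d /\ has_dim M d).

(* Main.v *)
Require Import Defs.
From mathcomp Require Import all_boot all_order all_algebra.
From mathcomp Require Import mpoly ring_quotient generic_quotient.
From mathcomp Require Import boolp zify ring.

(** Write M_H for the component of M in the squarefree degree with support H.
    For U in [n] let C_U(M) be the complex with j-th term the sum of the M_H
    over the j-element sets H disjoint from U, whose differential is signed
    multiplication by the variables.  Everything rests on a criterion in the
    style of Reisner and Hochster: a nonzero squarefree module N without
    components of support larger than d is Cohen-Macaulay of dimension d if and
    only if, for all A, the complex C_A(N) is exact at every j < d - #A.

    The criterion makes the theorem a matter of counting.  The complex C_A of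
    M|_{-W} is C_{A u W}(M), so the hypothesis says that C_{A' u W'}(M) is exact
    at j < d - #A' whenever #W' < l.  Passing to M^{<i>} only removes components
    of support larger than i, which does not affect exactness at j < i.  Given W
    with #W < l + d - i and any A, move as much as possible of A u W into a set
    W' with at most l - 1 elements; the rest A' satisfies i - #A <= d - #A', so
    C_A of M^{<i>}|_{-W} is exact at j < i - #A, as the criterion requires
    ([higher_CM_exact] and the final proof).

    From a regular sequence to exactness: if d polynomials without constant term
    form a regular sequence, the Koszul cohomology of the variables vanishes
    below d, because each of them acts on it by zero ([reg_kvanish]); the
    complexes C_A(N) are the parts of the Koszul complex in the degrees with
    entries 0 and -1 ([kvanish_exact]).

    From exactness to a regular sequence: in all other degrees the Koszul complex
    is zero or contractible, so Koszul cohomology vanishes below d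
    ([exact_kvanish]).  The elementary symmetric polynomials e_1, ..., e_d of all
    the variables then form a regular sequence, over any field, finite ones
    included ([elsyms_reg]).  By induction e_1, ..., e_{d-1} is regular on the
    quotient of N by the components of support size d; on that submodule it is
    regular because the submodule is a sum of shifted polynomial rings in d of
    the variables.  Finally, since x_v is a root of the polynomial with
    coefficients (up to sign) e_k and since e_k N = 0 for k > d, an element of
    N / (e_1, ..., e_{d-1}) N killed by e_d is killed by a power of every
    variable; Koszul vanishing leaves no such element but 0.

    The upper bounds for dimension and depth have a common source.  By linear
    algebra any d + 1 polynomials are algebraically dependent modulo the
    monomials that involve more than d variables, and the lowest term of a
    dependence relation gives an identity that is incompatible both with a chain
    of primes of length d + 1 and with a regular sequence of length d + 1
    ([collapses_few_support]). *)

Set Implicit Arguments.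
Unset Strict Implicit.
Unset Printing Implicit Defensive.

Import Order.TTheory GRing.Theory Num.Theory.
Local Open Scope ring_scope.

(** * Regular sequences on subquotients *)

Section Pairs.
Variables (R : comNzRingType) (T : lmodType R).
Implicit Types (A B C : T -> Prop) (f : R) (s : seq R).

Definition submod A := A 0 /\ forall (r : R) x y, A x -> A y -> A (r *: x + y).

Lemma submod0 A : submod A -> A 0. Proof. by case. Qed.
Lemma submodD A x y : submod A -> A x -> A y -> A (x + y).
Proof. by case=> _ AP Ax Ay; rewrite -[x]scale1r; apply: AP. Qed.
Lemma submodZ A r x : submod A -> A x -> A (r *: x).
Proof. by case=> A0 AP Ax; rewrite -[_ *: _]addr0; apply: AP. Qed.
Lemma submodN A x : submod A -> A x -> A (- x).
Proof. by move=> As Ax; rewrite -scaleN1r; apply: submodZ. Qed.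
Lemma submodB A x y : submod A -> A x -> A y -> A (x - y).
Proof. by move=> As Ax Ay; apply: submodD => //; apply: submodN. Qed.
Lemma submod_sum A (I : Type) (r : seq I) (P : pred I) (F : I -> T) :
  submod A -> (forall i, P i -> A (F i)) -> A (\sum_(i <- r | P i) F i).
Proof.
move=> As AF; elim/big_ind: _ => //; first exact: submod0.
by move=> x y; apply: submodD.
Qed.

Lemma submodT : submod (fun=> True). Proof. by []. Qed.

Lemma submod_zero : submod (fun x => x = 0).
Proof. by split=> // r x y -> ->; rewrite scaler0 addr0. Qed.

(** A subquotient C / A is represented by the pair (C, A), so that the successive
    quotients by a regular sequence need no new modules: f (C / A) is the image of
    [addmul C f A], and passing to (C / A) / f (C / A) only enlarges A. *)
Definition addmul C f A : T -> Prop :=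
  fun z => exists y w, [/\ C y, A w & z = f *: y + w].

Lemma addmul_submod C f A : submod C -> submod A -> submod (addmul C f A).
Proof.
move=> Cs As; split; first by exists 0, 0; rewrite scaler0 addr0; split=> //; apply: submod0.
move=> r x y [x1 [x2 [Cx1 Ax2 ->]]] [y1 [y2 [Cy1 Ay2 ->]]].
exists (r *: x1 + y1), (r *: x2 + y2).
split; [by case: Cs => _; apply|by case: As => _; apply|].
by rewrite !scalerDr !scalerA [f * r]mulrC addrACA.
Qed.

Lemma addmulW C f A z : submod C -> A z -> addmul C f A z.
Proof. by move=> Cs Az; exists 0, z; rewrite scaler0 add0r; split=> //; apply: submod0. Qed.

Lemma addmulM C f A z : submod A -> C z -> addmul C f A (f *: z).
Proof. by move=> As Cz; exists z, 0; rewrite addr0; split=> //; apply: submod0. Qed.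

Fixpoint adds C s A : T -> Prop :=
  if s is f :: s' then adds C s' (addmul C f A) else A.

Lemma adds_submod C s A : submod C -> submod A -> submod (adds C s A).
Proof. by move=> Cs; elim: s A => //= f s IH A As; apply/IH/addmul_submod. Qed.

Lemma addsW C s A z : submod C -> A z -> adds C s A z.
Proof. by move=> Cs; elim: s A => //= f s IH A Az; apply/IH/addmulW. Qed.

Lemma adds_mem C s A f z :
  submod C -> submod A -> f \in s -> C z -> adds C s A (f *: z).
Proof.
move=> Cs; elim: s A => //= g s IH A As; rewrite inE => /orP[/eqP ->|fs] Cz.
  by apply: addsW => //; apply: addmulM.
by apply: IH => //; apply: addmul_submod.
Qed.

Lemma adds_cat C s1 s2 A : adds C (s1 ++ s2) A = adds C s2 (adds C s1 A).
Proof. by elim: s1 A => //=. Qed.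

Definition nonzerodiv C f A := forall z, C z -> A (f *: z) -> A z.

Fixpoint reg C s A :=
  if s is f :: s' then nonzerodiv C f A /\ reg C s' (addmul C f A) else True.

Lemma reg_cat C s1 s2 A :
  reg C (s1 ++ s2) A <-> reg C s1 A /\ reg C s2 (adds C s1 A).
Proof.
elim: s1 A => [|f s1 IH] A /=; first by split=> // -[].
by rewrite IH; split=> [[? []]|[[]]].
Qed.

(** Regularity passes from the ends of 0 -> B1/A1 -> C/A -> C/B2 -> 0 to the middle.
    As f is a nonzerodivisor on C/B2, the sequence stays exact modulo f; this is the
    hypothesis needed to continue with the rest of s. *)
Lemma reg_ses s B1 A1 C A B2 :
  submod B1 -> submod A1 -> submod C -> submod A ->
  (forall z, B1 z -> C z) -> (forall z, A1 z -> A z) ->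
  (forall z, B1 z -> A z -> A1 z) ->
  (forall z, B2 z <-> exists b a, [/\ B1 b, A a & z = b + a]) ->
  reg B1 s A1 -> reg C s B2 -> reg C s A.
Proof.
move=> B1s + Cs + B1C; elim: s A1 A B2 => //= f s IH A1 A B2 A1s As A1A BA B2E.
have AB2 z : A z -> B2 z.
  by move=> Az; apply/B2E; exists 0, z; rewrite add0r; split=> //; apply: submod0.
have B1B2 z : B1 z -> B2 z.
  by move=> Az; apply/B2E; exists z, 0; rewrite addr0; split=> //; apply: submod0.
have B2s : submod B2.
  split; first by apply: AB2; apply: submod0.
  move=> r x y /B2E[b [a [Bb Aa ->]]] /B2E[b' [a' [Bb' Aa' ->]]]; apply/B2E.
  exists (r *: b + b'), (r *: a + a'); rewrite scalerDr addrACA.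
  by split=> //; [case: B1s => _; apply|case: As => _; apply].
move=> [f1 r1] [f2 r2]; split.
  move=> z Cz Afz; have /B2E[b [a [Bb Aa zE]]] := f2 z Cz (AB2 _ Afz).
  rewrite zE; apply: submodD => //; apply/A1A/f1 => //.
  apply: BA; first exact: submodZ.
  have -> : f *: b = f *: z - f *: a by rewrite zE scalerDr addrK.
  by apply: submodB => //; apply: submodZ.
apply: (IH (addmul B1 f A1) _ (addmul C f B2)) => //.
- exact: addmul_submod.
- exact: addmul_submod.
- by move=> z [y [w [By Aw ->]]]; exists y, w; split=> //; [apply: B1C|apply: A1A].
- move=> z Bz [c [a [Cc Aa zE]]].
  have /(f2 c Cc)/B2E[b [a' [Bb Aa' cE]]] : B2 (f *: c).
    have -> : f *: c = z - a by rewrite zE addrK.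
    by apply: submodB => //; [apply: B1B2|apply: AB2].
  exists b, (f *: a' + a); split=> //; last by rewrite zE cE scalerDr addrA.
  apply: BA; last by apply: submodD => //; apply: submodZ.
  have -> : f *: a' + a = z - f *: b by rewrite zE cE scalerDr -[X in X - _]addrA [RHS]addrC addKr.
  by apply: submodB => //; apply: submodZ.
- move=> z; split=> [[c [w [Cc /B2E[b [a [Bb Aa ->]]] ->]]]|].
    exists b, (f *: c + a); split=> //; last by rewrite addrCA.
    by exists c, a.
  move=> [b [_ [Bb [c [a [Cc Aa ->]]] ->]]].
  exists c, (b + a); split=> //; last by rewrite addrCA.
  by apply/B2E; exists b, a.
Qed.

End Pairs.

(** * The Koszul complex of the variables *)

Section Koszul.
Variables (R : comNzRingType) (T : lmodType R) (n : nat) (x : 'I_n -> R).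
Implicit Types (A : T -> Prop) (c b : {set 'I_n} -> T) (H : {set 'I_n}).

Definition ksign (v : 'I_n) H : bool := odd #|[set u in H | (u < v)%N]|.

(** The sign is a parameter because the subcomplex on the sets that contain a fixed set
    A, reindexed by H |-> H \ A, carries a different one. *)
Definition kdiff (sg : 'I_n -> {set 'I_n} -> bool) c H : T :=
  \sum_(v in H) ((-1) ^+ sg v H * x v) *: c (H :\ v).

Local Notation d := (kdiff ksign).

Lemma ksignD1 u v H : u \in H -> ksign v (H :\ u) = ksign v H (+) (u < v)%N.
Proof.
move=> uH; rewrite /ksign.
have -> : [set w in H :\ u | (w < v)%N] = [set w in H | (w < v)%N] :\ u.
  by apply/setP => w; rewrite !inE andbA.
rewrite [in RHS](cardsD1 u) oddD !inE uH /=.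
by case: (u < v)%N; case: odd.
Qed.

Lemma ksignU1 u v H : u \notin H -> ksign v (u |: H) = ksign v H (+) (u < v)%N.
Proof.
move=> uH; have := @ksignD1 u v (u |: H); rewrite setU11 setU1K // => /(_ isT) ->.
by rewrite -addbA addbb addbF.
Qed.

Lemma ksign_self v H : ksign v (v |: H) = ksign v H.
Proof.
rewrite /ksign; congr (odd #|pred_of_set _|); apply/setP => w; rewrite !inE.
by case: eqP => [->|//]; rewrite ltnn !andbF.
Qed.

Lemma ksign_selfD v H : ksign v (H :\ v) = ksign v H.
Proof.
rewrite /ksign; congr (odd #|pred_of_set _|); apply/setP => w; rewrite !inE.
by case: eqP => [->|//]; rewrite ltnn !andbF.
Qed.

Lemma kdiffD sg c b H : kdiff sg (fun G => c G + b G) H = kdiff sg c H + kdiff sg b H.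
Proof. by rewrite -big_split; apply: eq_bigr => v _; rewrite scalerDr. Qed.

Lemma kdiffZ sg (r : R) c H : kdiff sg (fun G => r *: c G) H = r *: kdiff sg c H.
Proof.
by rewrite scaler_sumr; apply: eq_bigr => v _; rewrite !scalerA [r * _]mulrC.
Qed.

Lemma kdiff_sum sg (I : Type) (s : seq I) (c : I -> {set 'I_n} -> T) H :
  kdiff sg (fun G => \sum_(a <- s) c a G) H = \sum_(a <- s) kdiff sg (c a) H.
Proof.
elim: s => [|a s IH].
  rewrite big_nil; apply: big1 => v _.
  by rewrite big_nil scaler0.
rewrite big_cons -IH -kdiffD; apply: eq_bigr => v _.
by rewrite big_cons.
Qed.

Lemma kdiff_in A sg c H : submod A -> (forall v, v \in H -> A (c (H :\ v))) -> A (kdiff sg c H).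
Proof.
by move=> As Ac; apply: submod_sum => // v vH; apply: submodZ => //; apply: Ac.
Qed.

Lemma kdiff_eq sg c b H : (forall v, v \in H -> c (H :\ v) = b (H :\ v)) ->
  kdiff sg c H = kdiff sg b H.
Proof. by move=> cb; apply: eq_bigr => v vH; rewrite cb. Qed.

(** The terms for (u, v) and (v, u) cancel.  Splitting the double sum along u < v pairs
    them off; the bare antisymmetry of the sum would not suffice in characteristic 2. *)
Lemma kdiff_kdiff c H : d (d c) H = 0.
Proof.
pose t (v u : 'I_n) : T :=
  ((-1) ^+ (ksign v H (+) ksign u (H :\ v)) * (x v * x u)) *: c (H :\ v :\ u).
have tC v u : u \in H -> v \in H -> u != v -> t v u = - t u v.
  move=> uH vH uv; rewrite /t -scaleNr; congr (_ *: c _); last first.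
    by apply/setP => w; rewrite !inE andbCA.
  rewrite (ksignD1 _ vH) (ksignD1 _ uH) [x v * _]mulrC -mulNr; congr (_ * _).
  have [uv'|uv'|/val_inj/eqP] := ltngtP u v; last by rewrite (negPf uv).
    by case: (ksign u H); case: (ksign v H); rewrite /= ?expr0 ?expr1 ?opprK.
    by case: (ksign u H); case: (ksign v H); rewrite /= ?expr0 ?expr1 ?opprK.
have -> : d (d c) H = \sum_(v in H) \sum_(u in H | u != v) t v u.
  apply: eq_bigr => v vH; rewrite scaler_sumr.
  apply: eq_big => [u|u _]; first by rewrite !inE andbC.
  by rewrite scalerA /t signr_addb; congr (_ *: _); rewrite mulrACA.
rewrite (exchange_big_dep (mem H)) /=; last by move=> v u _ /andP[].
pose S := \sum_(u in H) \sum_(v in H | (u < v)%N) t v u.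
have SE : \sum_(u in H) \sum_(v in H | (v < u)%N) t v u = - S.
  rewrite /S (exchange_big_dep (mem H)) /=; last by move=> v u _ /andP[].
  rewrite -sumrN; apply: eq_bigr => v vH; rewrite -sumrN.
  apply: eq_big => [u|u /andP[uH vu]]; first by rewrite vH.
  by rewrite tC //; apply: contraTneq vu => ->; rewrite ltnn andbF.
rewrite -[RHS](subrr S) -SE -big_split; apply: eq_bigr => u uH /=.
rewrite (bigID (fun v : 'I_n => (u < v)%N)) /=; congr (_ + _); apply: eq_bigl => v;
  by rewrite uH andTb -andbA -val_eqE /=; congr (_ && _); case: (ltngtP u v).
Qed.

Definition khomo (g : 'I_n -> R) c H : T :=
  \sum_(v in ~: H) ((-1) ^+ ksign v H * g v) *: c (v |: H).

(** An element of the ideal (x) acts on the Koszul complex by a map homotopic to zero. *)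
Lemma khomotopy (g : 'I_n -> R) c H :
  d (khomo g c) H + khomo g (d c) H = (\sum_v x v * g v) *: c H.
Proof.
have -> : d (khomo g c) H = \sum_(u in H) (x u * g u) *: c H +
    \sum_(u in H) \sum_(v in ~: H)
      ((-1) ^+ (ksign u H (+) ksign v (H :\ u)) * (x u * g v)) *: c (v |: H :\ u).
  rewrite -big_split; apply: eq_bigr => u uH /=.
  rewrite scaler_sumr (bigD1 u) /=; last by rewrite !inE eqxx.
  congr (_ + _).
    rewrite scalerA setD1K // ksign_selfD mulrACA -signr_addb addbb.
    by rewrite expr0 mul1r.
  apply: eq_big => [v|v _]; last by rewrite scalerA signr_addb; congr (_ *: _); rewrite mulrACA.
  by rewrite !inE negb_and negbK; case: eqP => [->|_]; rewrite ?uH //= andbT.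
have -> : khomo g (d c) H = \sum_(v in ~: H) (x v * g v) *: c H +
    \sum_(v in ~: H) \sum_(u in H)
      ((-1) ^+ (ksign v H (+) ksign u (v |: H)) * (x u * g v)) *: c (v |: H :\ u).
  rewrite -big_split; apply: eq_bigr => v vH /=; rewrite inE in vH.
  rewrite scaler_sumr (bigD1 v) ?setU11 //=; congr (_ + _).
    rewrite scalerA setU1K // ksign_self mulrACA -signr_addb addbb expr0 mul1r.
    by rewrite mulrC.
  apply: eq_big => [u|u /andP[_ uv]].
    by rewrite !inE; case: eqP => [->|]; rewrite ?(negPf vH) ?andbF ?andbT.
  rewrite scalerA signr_addb; congr (_ *: c _).
    by rewrite mulrACA; congr (_ * _); rewrite mulrC.
  apply/setP => w; rewrite !inE.
  by case: (eqVneq w v) => [->|]; rewrite ?orbF ?orbT //= 1?eq_sym ?uv // andbT.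
rewrite addrACA [X in _ + X](_ : _ = 0) ?addr0; last first.
  rewrite [X in _ + X](exchange_big_dep (mem H)) //= -big_split big1 // => u uH.
  rewrite /= [X in _ + X](eq_bigl (mem (~: H))) => [|v]; last by rewrite uH andbT.
  rewrite -big_split big1 // => v vH /=; rewrite inE in vH.
  rewrite -scalerDl -mulrDl (ksignD1 _ uH) (ksignU1 _ vH).
  have [uv|uv|/val_inj uv] := ltngtP u v; last by rewrite -uv uH in vH.
    by case: (ksign u H); case: (ksign v H); rewrite /= ?expr0 ?expr1 ?addNr ?addrN mul0r scale0r.
  by case: (ksign u H); case: (ksign v H); rewrite /= ?expr0 ?expr1 ?addNr ?addrN mul0r scale0r.
rewrite scaler_suml [RHS](bigID (mem H)) /=; congr (_ + _).
by apply: eq_bigl => v; rewrite inE.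
Qed.

(** The Koszul cohomology of T / A in positions j < t is zero. *)
Definition kvanish A t := forall j c, (j < t)%N ->
  (forall H, #|H| = j.+1 -> A (d c H)) ->
  exists b, forall H, #|H| = j -> A (c H - d b H).

Lemma cochain_choice (Q : {set 'I_n} -> T -> Prop) (P : {set 'I_n} -> bool) :
  (forall H, P H -> exists y, Q H y) -> exists b, forall H, P H -> Q H (b H).
Proof.
move=> PQ; have /choice[b bP] : forall H, exists y, P H -> Q H y.
  by move=> H; case: (boolP (P H)) => [/PQ[y Qy]|]; [exists y|exists 0].
by exists b.
Qed.

(** The long exact cohomology sequence of f : T/A -> T/A: a cocycle modulo f has
    boundary f w, where w is a cocycle of the next position, hence a coboundary. *)
Lemma kvanish_addmul f A t : submod A ->
  nonzerodiv (fun=> True) f A -> kvanish A t.+1 -> kvanish (addmul (fun=> True) f A) t.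
Proof.
move=> As fA KV j c jt cA.
have /cochain_choice[w wP] : forall H, #|H| == j.+1 ->
    exists y, A (d c H - f *: y).
  move=> H /eqP/cA[y [z [_ Az ->]]]; exists y.
  by rewrite addrC addKr.
have [|b bP] := KV j.+1 w jt.
  move=> H Hj; apply: fA => //; rewrite -kdiffZ.
  have -> : kdiff ksign (fun G => f *: w G) H =
      - d (fun G => d c G - f *: w G) H.
    rewrite -[d (fun G => _ - _) H]/(d (fun G => d c G + - (f *: w G)) H).
    rewrite kdiffD kdiff_kdiff add0r -[LHS]opprK; congr (- _).
    by rewrite -scaleN1r -kdiffZ; apply: kdiff_eq => v _; rewrite scaleN1r.
  apply: submodN => //; apply: kdiff_in => // v vH; apply: wP.
  by have := cardsD1 v H; rewrite Hj vH add1n => -[<-].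
have [|b' b'P] := KV j (fun H => c H - f *: b H) (ltnW jt).
  move=> H Hj; rewrite kdiffD.
  have -> : d (fun G => - (f *: b G)) H = - (f *: d b H).
    by rewrite -kdiffZ -scaleN1r -kdiffZ; apply: kdiff_eq => v _; rewrite scaleN1r.
  rewrite -[d c H](subrK (f *: w H)) -addrA -scalerBr.
  apply: submodD => //; first by apply: wP; apply/eqP.
  by apply: submodZ => //; apply: bP.
exists b' => H /b'P; rewrite addrAC => Ab.
by exists (b H), (c H - kdiff ksign b' H - f *: b H); split; rewrite // [RHS]addrC subrK.
Qed.

(** Multiplication by f is injective on cohomology below t + 1, by the vanishing for the
    quotient by f and the long exact sequence, and zero because f lies in (x). *)
Lemma kvanish_reg f A t (g : 'I_n -> R) : submod A -> f = \sum_v x v * g v ->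
  nonzerodiv (fun=> True) f A -> kvanish (addmul (fun=> True) f A) t -> kvanish A t.+1.
Proof.
move=> As fE fA KV [|j] c jt cA.
  exists (fun=> 0) => H H0; apply: fA => //; rewrite scalerBr -kdiffZ.
  rewrite [kdiff _ _ _]big_pred0 => [|v]; last by rewrite (cards0_eq H0) inE.
  rewrite subr0 fE -khomotopy [kdiff _ _ _]big_pred0 => [|v]; last by rewrite (cards0_eq H0) inE.
  rewrite add0r; apply: submod_sum => // v vH; apply: submodZ => //; apply: cA.
  by rewrite (cards0_eq H0) setU0 cards1.
set b := khomo g c.
have bP H : #|H| = j.+1 -> A (f *: c H - d b H).
  move=> Hj; rewrite fE -khomotopy -/b addrC addKr.
  apply: submod_sum => // v; rewrite inE => vH; apply: submodZ => //; apply: cA.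
  by rewrite cardsU1 vH Hj.
have [|a aP] := KV j b jt.
  move=> H Hj; exists (c H), (- (f *: c H - d b H)); split=> //.
    by apply: submodN => //; apply: bP.
  by rewrite opprB [RHS]addrC subrK.
have /cochain_choice[b' b'P] : forall H, #|H| == j ->
    exists y, A (b H - d a H - f *: y).
  move=> H /eqP/aP[y [z [_ Az ->]]]; exists y.
  by rewrite addrC addKr.
exists b' => H Hj; apply: fA => //; rewrite scalerBr -kdiffZ.
have -> : f *: c H - d (fun G => f *: b' G) H =
    (f *: c H - d b H) + d (fun G => b G - d a G - f *: b' G) H.
  have -> : d (fun G => b G - d a G - f *: b' G) H =
      d b H - d (d a) H - d (fun G => f *: b' G) H.
    have dN c' : d (fun G => - c' G) H = - d c' H.
      by rewrite -scaleN1r -kdiffZ; apply: kdiff_eq => v _; rewrite scaleN1r.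
    by rewrite !kdiffD !dN.
  by rewrite kdiff_kdiff subr0 addrA subrK.
apply: submodD => //; first exact: bP.
apply: kdiff_in => // v vH; apply: b'P.
by have := cardsD1 v H; rewrite Hj vH add1n => -[<-].
Qed.

Lemma kvanish_adds s A t : submod A ->
  reg (fun=> True) s A -> kvanish A (size s + t) -> kvanish (adds (fun=> True) s A) t.
Proof.
elim: s A => //= f s IH A As [fA sA] KV; apply: IH => //.
  exact: addmul_submod.
exact: kvanish_addmul.
Qed.

(** Induction along the sequence, from the last quotient back to T / A. *)
Lemma reg_kvanish s A : submod A ->
  (forall f, f \in s -> exists g : 'I_n -> R, f = \sum_v x v * g v) ->
  reg (fun=> True) s A -> kvanish A (size s).
Proof.
elim: s A => [|f s IH] A As sx /=; first by move=> _ j c; rewrite ltn0.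
move=> [fA sA]; have [g fE] := sx f (mem_head _ _).
apply: (kvanish_reg As fE fA); apply: IH => //; first exact: addmul_submod.
by move=> h hs; apply: sx; rewrite inE hs orbT.
Qed.

End Koszul.

Arguments ksign {n} v H.

(** * Iterated boundary ideals *)

Section Boundary.
Variable R : comNzRingType.
Implicit Types (J : R -> Prop) (f g r : R) (s : seq R).

Definition ideal J := J 0 /\ forall r f g, J f -> J g -> J (r * f + g).

(** The ideal (J : f^oo) + (f), which is the boundary ideal of Coquand and Lombardi.  Its
    zeros are the zeros of f in the closure of the part of V(J) where f does not vanish,
    so its dimension is smaller than that of J; iterating it over d + 1 elements produces
    the unit ideal when the dimension is at most d. *)
Definition boundary J f : R -> Prop :=
  fun g => exists k r, J (f ^+ k * (g + f * r)).

Fixpoint collapses J s : Prop :=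
  if s is f :: s' then collapses (boundary J f) s' else J 1.

Lemma idealM J r f : ideal J -> J f -> J (r * f).
Proof. by move=> [J0 JP] Jf; rewrite -[_ * _]addr0; apply: JP. Qed.

Lemma ideal_sum J (I : eqType) (s : seq I) (F : I -> R) :
  ideal J -> (forall i, i \in s -> J (F i)) -> J (\sum_(i <- s) F i).
Proof.
move=> [J0 JP] JF; rewrite big_seq; elim/big_ind: _ => // x y Jx Jy.
by rewrite -[x]mul1r; apply: JP.
Qed.

Lemma boundary_ideal J f : ideal J -> ideal (boundary J f).
Proof.
move=> [J0 JP]; split; first by exists 0%N, 0; rewrite mulr0 addr0 mulr0.
move=> r g h [k [u Jg]] [l [v Jh]]; exists (k + l)%N, (r * u + v).
have -> : f ^+ (k + l) * (r * g + h + f * (r * u + v)) =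
    (f ^+ l * r) * (f ^+ k * (g + f * u)) + (f ^+ k * (f ^+ l * (h + f * v)) + 0).
  by rewrite exprD; ring.
by apply: (JP) => //; apply: JP.
Qed.

(** If J lies in a prime P that misses f, then the boundary ideal lies in every prime
    that contains both P and f; climbing the chain would put 1 in the last prime. *)
Lemma collapses_prime J s (P : nat -> {pred R}) :
  (forall f, J f -> f \in P 0%N) ->
  (forall j, (j <= size s)%N -> idealr_closed (P j) /\ prime_idealr_closed (P j)) ->
  (forall j, (j < size s)%N ->
     [/\ {subset P j <= P j.+1}, s`_j \in P j.+1 & s`_j \notin P j]) ->
  ~ collapses J s.
Proof.
elim: s J P => [|f s IH] J P JP Pp Ps /=.
  by move=> /JP; have [[_ /negPf ->]] := Pp 0%N isT.
apply: (IH _ (fun j => P j.+1)) => [g [k [r /JP]]|j js|j js]; last 2 first.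
- exact: Pp.
- exact: Ps.
have [P01 fP1 fP0] := Ps 0%N isT.
have [[P0i P0N P0P] P0p] := Pp 0%N isT.
have [[P1i P1N P1P] _] := Pp 1%N isT.
have fk : f ^+ k \notin P 0%N.
  elim: k => [|k IHk]; rewrite ?expr0 // exprS.
  by apply/negP => /P0p; rewrite (negPf fP0) (negPf IHk).
move=> /P0p; rewrite (negPf fk) /= => /P01 gfr.
have -> : g = (- r) * f + (g + f * r) by rewrite mulNr addrC mulrC addrK.
exact: P1P.
Qed.

(** If J maps T into A and f is a nonzerodivisor on T/A, then f^k (g + f r) in J forces
    g T into f T + A: the boundary ideal kills the quotient by f. *)
Lemma collapses_reg (T : lmodType R) (A : T -> Prop) J s :
  submod A -> (forall f y, J f -> A (f *: y)) -> reg (fun=> True) s A ->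
  collapses J s -> forall y, adds (fun=> True) s A y.
Proof.
elim: s J A => [|f s IH] J A As JA /=; first by move=> _ J1 y; rewrite -[y]scale1r; apply: JA.
move=> [fA sA] Js; apply: (IH (boundary J f)) => //; first exact: addmul_submod.
move=> g y [k [r Jg]]; have := JA _ y Jg; rewrite -scalerA => gA.
have {gA} gA : A ((g + f * r) *: y).
  by elim: k gA {Jg} => [|k IHk]; rewrite ?expr0 ?scale1r // exprS -scalerA => /fA - /(_ I)/IHk.
exists (- r *: y), ((g + f * r) *: y); split=> //.
by rewrite scalerA -scalerDl; congr (_ *: y); ring.
Qed.

End Boundary.

(** * Algebraic dependence modulo monomials with large support *)

Section Dependence.
Variables (K : fieldType) (m : nat).
Local Notation R := {mpoly K[m]}.
Implicit Types (J : R -> Prop) (s : seq R).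

Fixpoint box N k : seq (seq nat) :=
  if k is k'.+1 then [seq a :: u | a <- iota 0 N, u <- box N k'] else [:: [::]].

Fixpoint monomial s (u : seq nat) : R :=
  match s, u with f :: s', a :: u' => f ^+ a * monomial s' u' | _, _ => 1 end.

Lemma size_box N k : size (box N k) = (N ^ k)%N.
Proof. by elim: k => //= k IH; rewrite size_allpairs size_iota IH expnS. Qed.

Lemma uniq_box N k : uniq (box N k).
Proof.
elim: k => //= k IH; apply: allpairs_uniq => //; first exact: iota_uniq.
by move=> [a u] [b v] _ _ [-> ->].
Qed.

(** In a dependence relation factor out the lowest power a of f that occurs.  It reads
    f^a (g + f r) in J, with g the value of a nonzero polynomial at the remaining
    elements; g lies in the boundary ideal, and the induction goes on. *)
Lemma collapses_dependent N J s (q : seq nat -> K) :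
  ideal J -> has (fun u => q u != 0) (box N (size s)) ->
  J (\sum_(u <- box N (size s)) (q u)%:MP * monomial s u) -> collapses J s.
Proof.
elim: s J q => [|f s IH] J q Ji /=.
  rewrite orbF big_seq1 mulr1 => q0 Jq.
  rewrite -(_ : ((q [::])^-1)%:MP * (q [::])%:MP = 1); first exact: idealM.
  by rewrite -mpolyCM mulVf // mpolyC1.
pose Q a := has (fun u => q (a :: u) != 0) (box N (size s)).
pose E a : R := \sum_(u <- box N (size s)) (q (a :: u))%:MP * monomial s u.
move=> q0 Jq; have exQ : exists a, (a < N)%N && Q a.
  move: q0 => /hasP[_ /allpairsP[[a u] [aN ub ->]] qau]; exists a.
  by rewrite mem_iota /= add0n in aN; rewrite aN; apply/hasP; exists u.
case: (ex_minnP exQ) => a /andP[aN Qa] amin.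
apply: (IH (boundary J f) (fun u => q (a :: u))) => //.
  exact: boundary_ideal.
exists a, (\sum_(b <- iota 0 N | (a < b)%N) f ^+ (b - a.+1) * E b).
move: Jq; rewrite big_allpairs_dep /=.
have -> : \sum_(b <- iota 0 N) \sum_(u <- box N (size s))
    (q (b :: u))%:MP * (f ^+ b * monomial s u) = \sum_(b <- iota 0 N) f ^+ b * E b.
  apply: eq_bigr => b _; rewrite mulr_sumr; apply: eq_bigr => u _.
  by rewrite mulrCA.
rewrite (bigD1_seq a) ?iota_uniq ?mem_iota //= mulrDr -/(E a).
rewrite (bigID (fun b => (a < b)%N)) /= [X in _ + (_ + X)]big_seq_cond.
rewrite [X in _ + (_ + X)]big1 ?addr0 => [|b].
  congr (J (_ + _)); rewrite !mulr_sumr.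
  rewrite [LHS](eq_bigl (fun b => (a < b)%N)) => [|b]; last first.
    by rewrite andb_idl // => ab; rewrite gtn_eqF.
  apply: eq_bigr => b ab; rewrite !mulrA -exprSr -exprD; congr (f ^+ _ * _).
  lia.
rewrite mem_iota => /and3P[bN ba]; rewrite -leqNgt => ab.
rewrite /E big_seq big1 ?mulr0 // => u ub.
have [->|qb] := eqVneq (q (b :: u)) 0; first by rewrite mpolyC0 mul0r.
suff : (a <= b)%N by lia.
by apply: amin; apply/andP; split; [move: bN; rewrite add0n|apply/hasP; exists u].
Qed.

Lemma card_few_support D k :
  (#|[set E : {ffun 'I_m -> 'I_D.+1} | #|[set i | E i != ord0]| <= k]|
     <= 2 ^ m * D.+1 ^ k)%N.
Proof.
rewrite -sum1_card (partition_big (fun E : {ffun 'I_m -> 'I_D.+1} => [set i | E i != ord0])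
  (fun F : {set 'I_m} => (#|F| <= k)%N)) /=; last by move=> E; rewrite inE.
apply: leq_trans (_ : (\sum_(F : {set 'I_m} | #|F| <= k) D.+1 ^ k <= _)%N).
  apply: leq_sum => F Fk; rewrite sum1_card.
  apply: leq_trans (_ : (D.+1 ^ #|F| <= _)%N); last by rewrite leq_pexp2l.
  rewrite -[X in (_ <= X ^ _)%N]card_ord -(card_pffun_on ord0 F (mem 'I_D.+1)).
  apply: subset_leq_card; apply/subsetP => E /andP[_ /eqP FE].
  apply/pffun_onP; split=> //; apply/subsetP => i.
  by rewrite -FE !inE.
rewrite sum_nat_const leq_mul2r; apply/orP; right.
apply: leq_trans (max_card _) _.
by rewrite -cardsT -powersetT card_powerset cardsT card_ord.
Qed.

Lemma msizeM_leq (p q : R) : (msize (p * q) <= (msize p + msize q).-1)%N.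
Proof.
have [->|p0] := eqVneq p 0; first by rewrite mul0r msize0.
have [->|q0] := eqVneq q 0; first by rewrite mulr0 msize0.
by rewrite msizeM.
Qed.

Lemma msize_monomial N d s u :
  (forall f, f \in s -> (msize f <= d.+1)%N) -> u \in box N (size s) ->
  (msize (monomial s u) <= (size s * N * d).+1)%N.
Proof.
move=> sd; elim: s u sd => [|f s IH] u sd /=.
  by move=> _; rewrite msize1.
move=> /allpairsP[[a v] [/= aN vb ->]] /=; rewrite mem_iota in aN.
have fa : (msize (f ^+ a) <= (a * d).+1)%N.
  elim: (a) => [|b IHb]; first by rewrite expr0 msize1.
  have fd := sd f (mem_head _ _).
  by rewrite exprS; apply: leq_trans (msizeM_leq _ _) _; lia.
have {}IH := IH v (fun g gs => sd g (mem_behead (s := f :: s) gs)) vb.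
apply: leq_trans (msizeM_leq _ _) _.
have : (a * d <= N * d)%N by rewrite leq_mul2r; apply/orP; right; lia.
nia.
Qed.

(** With k + 1 elements of degree at most d there are N^(k+1) monomials in them with
    exponents below N, of degree at most D = (k+1) N d, while at most 2^m (D+1)^k monomials
    of degree at most D involve at most k variables.  For large N some nonzero
    combination has no such monomial, so it lies in J. *)
Lemma collapses_few_support J s : ideal J ->
  (forall u : 'X_{1..m}, (size s <= #|supp (deg_of_mnm u)|)%N -> J 'X_[u]) ->
  collapses J s.
Proof.
move=> Ji JX; have [s0|] := posnP (size s).
  rewrite (size0nil s0) /=; have := JX 0%MM; rewrite mpolyX0; apply.
  by rewrite s0.
case ks : (size s) => [//|k] _.
pose d := \max_(f <- s) msize f.
have sd f : f \in s -> (msize f <= d.+1)%N.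
  by move=> fs; apply: leqW; rewrite /d; apply: (leq_bigmax_seq (F := fun f => msize f)).
(* D + 1 <= c N, so 2^m (D + 1)^k <= 2^m c^k N^k < N^(k+1). *)
pose c := (k.+1 * d + 1)%N; pose N := (2 ^ m * c ^ k).+1.
pose D := (k.+1 * N * d)%N.
pose B := [set E : {ffun 'I_m -> 'I_D.+1} | (#|[set i | E i != ord0]| <= k)%N].
have BN : (#|B| < N ^ k.+1)%N.
  apply: leq_ltn_trans (card_few_support D k) _.
  have DN : (D.+1 <= c * N)%N by rewrite /D /c /N; nia.
  apply: leq_ltn_trans (_ : (2 ^ m * (c * N) ^ k < _)%N).
    by rewrite leq_mul2l; apply/orP; right; case: (k) => // j; rewrite leq_exp2r.
  rewrite expnMn mulnA expnS ltn_mul2r expn_gt0 /=.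
  by rewrite /N ltnSn.
pose mnm_of (E : {ffun 'I_m -> 'I_D.+1}) : 'X_{1..m} := [multinom (E i : nat) | i < m].
pose A : 'M[K]_(N ^ k.+1, #|B|) :=
  \matrix_(a, e) (monomial s (nth [::] (box N k.+1) a))@_(mnm_of (enum_val e)).
have /rowV0Pn[v /sub_kermxP vA v0] : kermx A != 0.
  rewrite kermx_eq0 /row_free neq_ltn; apply/orP; left.
  exact: leq_ltn_trans (rank_leq_col _) BN.
pose q (u : seq nat) : K := if insub (index u (box N k.+1)) is Some a then v 0 a else 0.
have qE (a : 'I_(N ^ k.+1)) : q (nth [::] (box N k.+1) a) = v 0 a.
  rewrite /q index_uniq ?uniq_box ?size_box //.
  by rewrite valK.
apply: (collapses_dependent (N := N) (q := q)) => //; rewrite ks.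
  have /existsP[a va] : [exists a, v 0 a != 0].
    apply: contraR v0 => /existsPn v0; apply/eqP/rowP => a; rewrite mxE.
    by apply/eqP; rewrite -[_ == _]negbK.
  apply/hasP; exists (nth [::] (box N k.+1) a); last by rewrite qE.
  by rewrite mem_nth // size_box.
set p : R := \sum_(u <- _) _.
suff pX u : u \in msupp p -> (k < #|supp (deg_of_mnm u)|)%N.
  rewrite [p]mpolyE; apply: ideal_sum => // u /pX ku.
  by rewrite -mul_mpolyC; apply: idealM => //; apply: JX; rewrite ks.
rewrite mcoeff_msupp; apply: contraNltn => uk.
have [uD|uD] := ltnP (mdeg u) D.+1; last first.
  apply/eqP/memN_msupp_eq0; apply: msize_mdeg_ge; apply: leq_trans uD.
  rewrite /p big_seq; elim/big_ind: _ => [|x y xD yD|w wb]; first by rewrite msize0.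
    by apply: leq_trans (msizeD_le _ _) _; rewrite geq_max xD.
  rewrite mul_mpolyC; apply: leq_trans (msizeZ_le _ _) _.
  by rewrite /D -ks; apply: msize_monomial => //; rewrite ks.
have uiD i : (u i < D.+1)%N.
  by apply: leq_ltn_trans uD; rewrite mdegE (bigD1 i) //= leq_addr.
pose E := [ffun i => Ordinal (uiD i)] : {ffun 'I_m -> 'I_D.+1}.
have Eu : mnm_of E = u by apply/mnmP => i; rewrite mnmE ffunE.
have EB : E \in B.
  rewrite inE; apply: leq_trans uk; apply: subset_leq_card; apply/subsetP => i.
  by rewrite !inE !ffunE.
have := congr1 (fun w : 'rV_#|B| => w 0 (enum_rank_in EB E)) vA.
rewrite !mxE => vA0; apply/eqP; rewrite -[RHS]vA0 /p raddf_sum.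
rewrite (big_nth [::]) size_box big_mkord; apply: eq_bigr => a _.
by rewrite mxE enum_rankK_in // Eu /= mcoeffCM qE.
Qed.

End Dependence.

(** * Squarefree modules over a subset of the variables *)

Definition unit_deg n (v : 'I_n) : Zdeg n := [ffun i => (i == v)%:Z].
Definition set_deg n (H : {set 'I_n}) : Zdeg n := [ffun i => (i \in H)%:Z].

Lemma unit_degE n (v : 'I_n) : unit_deg v = deg_of_mnm U_(v)%MM.
Proof. by apply/ffunP => i; rewrite !ffunE mnm1E eq_sym. Qed.

Lemma set_degD1 n (H : {set 'I_n}) v : v \in H -> set_deg H = set_deg (H :\ v) + unit_deg v.
Proof.
move=> vH; apply/ffunP => i; rewrite !ffunE !inE.
by case: eqP => [->|]; rewrite ?vH //= addr0.
Qed.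

Lemma set_degU1 n (H : {set 'I_n}) v :
  v \notin H -> set_deg (v |: H) = set_deg H + unit_deg v.
Proof. by move=> vH; rewrite (set_degD1 (setU11 v H)) setU1K. Qed.

Lemma supp_set_deg n (H : {set 'I_n}) : supp (set_deg H) = H.
Proof. by apply/setP => i; rewrite inE ffunE; case: (i \in H). Qed.

Lemma supp_unitD n (a : Zdeg n) v : nneg_deg a -> supp (a + unit_deg v) = v |: supp a.
Proof.
move=> a0; rewrite unit_degE suppD // setUC; congr (_ :|: _).
by apply/setP => i; rewrite !inE -unit_degE ffunE; case: (i == v).
Qed.

(** Degrees always live in Z^n, although the polynomial ring may have fewer variables:
    the variable of index v acts by zero when v is not in the image of g. *)
Definition lvar (K : fieldType) m n (g : 'I_m -> 'I_n) (v : 'I_n) : {mpoly K[m]} :=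
  if [pick j | g j == v] is Some j then 'X_j else 0.

Lemma lvar_emb (K : fieldType) m n (g : 'I_m -> 'I_n) j :
  injective g -> lvar K g (g j) = 'X_j.
Proof.
move=> gI; rewrite /lvar; case: pickP => [k /eqP/gI -> //|/(_ j)].
by rewrite eqxx.
Qed.

Lemma lvar_out (K : fieldType) m n (g : 'I_m -> 'I_n) v :
  (forall j, g j != v) -> lvar K g v = 0.
Proof.
by move=> gv; rewrite /lvar; case: pickP => // k /eqP gk; have := gv k; rewrite gk eqxx.
Qed.

(** A squarefree module given by its projections onto the components.  The ring has m
    variables, placed among the n coordinates of the degree by [emb]; this covers a
    squarefree module over all variables (m = n) and its restrictions to a subset at
    once, so that the sets H index the components of both. *)
Record sqmod (K : fieldType) (m n : nat) (T : lmodType {mpoly K[m]}) := Sqmod {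
  emb : 'I_m -> 'I_n;
  emb_inj : injective emb;
  pr : Zdeg n -> T -> T;
  prD : forall a x y, pr a (x + y) = pr a x + pr a y;
  prZ : forall a (c : K) x, pr a (c%:MP *: x) = c%:MP *: pr a x;
  pr_pr : forall a b x, pr a (pr b x) = if a == b then pr b x else 0;
  pr_fin : forall x, exists2 s, uniq s & x = \sum_(a <- s) pr a x;
  pr_ge0 : forall a x, pr a x <> 0 -> nneg_deg a;
  pr_var : forall a v x, pr (a + unit_deg v) (lvar K emb v *: x) = lvar K emb v *: pr a x;
  var_inj : forall (a : Zdeg n) v x, 0 < a v -> pr a x = x -> lvar K emb v *: x = 0 -> x = 0;
  var_surj : forall (a : Zdeg n) v x, 0 < a v -> pr (a + unit_deg v) x = x ->
    exists2 y, pr a y = y & x = lvar K emb v *: y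
}.

Section Sqmod.
Variables (K : fieldType) (m n : nat) (T : lmodType {mpoly K[m]}) (S : sqmod n T).
Local Notation R := {mpoly K[m]}.
Local Notation x := (lvar K (emb S)).
Local Notation pr := (pr S).
Local Notation d := (kdiff x ksign).
Implicit Types (a : Zdeg n) (t u : T) (D : Zdeg n -> Prop).
Implicit Types (H G A U : {set 'I_n}) (v p : 'I_n).

Definition hdeg a t := pr a t = t.

Lemma pr0 a : pr a 0 = 0.
Proof. by apply: (addrI (pr a 0)); rewrite -prD !addr0. Qed.

Lemma prN a t : pr a (- t) = - pr a t.
Proof. by apply/eqP; rewrite -addr_eq0 addrC -prD subrr pr0. Qed.

Lemma prB a t u : pr a (t - u) = pr a t - pr a u.
Proof. by rewrite prD prN. Qed.

Lemma pr_bigsum a (I : Type) (s : seq I) (P : pred I) (F : I -> T) :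
  pr a (\sum_(i <- s | P i) F i) = \sum_(i <- s | P i) pr a (F i).
Proof. by apply: (big_morph _ (prD S a) (pr0 a)). Qed.

Lemma hom_pr a t : hdeg a (pr a t).
Proof. by rewrite /hdeg pr_pr eqxx. Qed.

Lemma pr_ext t : (forall a, pr a t = 0) -> t = 0.
Proof. by move=> t0; have [s _ ->] := pr_fin S t; rewrite big1. Qed.

Lemma pr_support t : exists s : seq (Zdeg n), forall L : seq (Zdeg n), uniq L -> {subset s <= L} ->
  t = \sum_(a <- L) pr a t.
Proof.
have [s us tE] := pr_fin S t; exists s => L uL sL.
rewrite [LHS]tE [RHS](bigID (mem s)) /= [X in _ + X]big1 ?addr0 => [|a /negPf as_]; last first.
  rewrite tE pr_bigsum big_seq big1 // => b bs; rewrite pr_pr.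
  by case: eqP => // ab; rewrite ab bs in as_.
rewrite -[RHS]big_filter; apply: perm_big; apply: uniq_perm => //; first exact: filter_uniq.
by move=> a; rewrite mem_filter /= andb_idr //; apply: sL.
Qed.

Lemma pr_mulvar a v t : pr a (x v *: t) = x v *: pr (a - unit_deg v) t.
Proof. by rewrite -pr_var subrK. Qed.

Lemma pr_sign a (e : bool) t : pr a ((-1) ^+ e *: t) = (-1) ^+ e *: pr a t.
Proof. by case: e; rewrite ?expr0 ?scale1r // expr1 !scaleN1r prN. Qed.

Lemma hom0 a : hdeg a 0. Proof. exact: pr0. Qed.

Lemma homB a t u : hdeg a t -> hdeg a u -> hdeg a (t - u).
Proof. by rewrite /hdeg prB => -> ->. Qed.

Lemma hom_sign a (e : bool) t : hdeg a t -> hdeg a ((-1) ^+ e *: t).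
Proof. by rewrite /hdeg pr_sign => ->. Qed.

Lemma hom_var a v t : hdeg a t -> hdeg (a + unit_deg v) (x v *: t).
Proof. by rewrite /hdeg pr_var => ->. Qed.

Lemma hom_neg a t v : hdeg a t -> a v < 0 -> t = 0.
Proof.
move=> at_ av; apply: contrapT => t0; have := @pr_ge0 _ _ _ _ S a t.
by rewrite at_ => /(_ t0)/(_ v); rewrite leNgt av.
Qed.

Lemma hom_nneg a t : hdeg a t -> t <> 0 -> nneg_deg a.
Proof. by move=> at_ t0; apply: (@pr_ge0 _ _ _ _ S a t); rewrite at_. Qed.

Lemma pr_hom a (b : Zdeg n) t : hdeg b t -> pr a t = if a == b then t else 0.
Proof. by move=> <-; rewrite pr_pr. Qed.

Lemma pr_kdiff sg c a H : pr (a + set_deg H) (kdiff x sg c H) =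
  kdiff x sg (fun G => pr (a + set_deg G) (c G)) H.
Proof.
rewrite pr_bigsum; apply: eq_bigr => v vH.
by rewrite -!scalerA pr_sign (set_degD1 vH) addrA pr_var.
Qed.

Lemma hom_kdiff sg c a H : (forall v, v \in H -> hdeg (a + set_deg (H :\ v)) (c (H :\ v))) ->
  hdeg (a + set_deg H) (kdiff x sg c H).
Proof.
by move=> cH; rewrite /hdeg pr_kdiff; apply: kdiff_eq => v /cH.
Qed.

Definition in_deg D t := forall a, ~ D a -> pr a t = 0.

Definition stable_deg D := forall a v, nneg_deg a -> D a -> D (a + unit_deg v).

Lemma varE j : x (emb S j) = 'X_j.
Proof. exact/lvar_emb/emb_inj. Qed.

Lemma submod_gen (A : T -> Prop) :
  A 0 -> (forall t u, A t -> A u -> A (t + u)) -> (forall (c : K) t, A t -> A (c%:MP *: t)) ->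
  (forall v t, A t -> A (x v *: t)) -> submod A.
Proof.
move=> A0 AD AC AX; split=> // r t u At Au; apply: (AD) => //.
rewrite [r]mpolyE scaler_suml; apply: (big_ind A) => // mu _.
rewrite -mul_mpolyC -scalerA; apply: AC; rewrite mpolyXE_id.
apply: (big_rec (fun q : R => A (q *: t))) => [|j p _ Ap]; first by rewrite scale1r.
rewrite -scalerA; elim: (mu j) => [|k IH]; first by rewrite expr0 scale1r.
by rewrite exprS -scalerA -{1}varE; apply: AX.
Qed.

Lemma in_deg_submod D : stable_deg D -> submod (in_deg D).
Proof.
move=> DS; apply: submod_gen => [a _|t u tD uD a Da|c t tD a Da|v t tD a Da].
- exact: pr0.
- by rewrite prD tD // uD // addr0.
- by rewrite prZ tD // scaler0.
rewrite pr_mulvar; have [->|t0] := eqVneq (pr (a - unit_deg v) t) 0; first by rewrite scaler0.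
rewrite tD ?scaler0 // => Dav; apply: Da; rewrite -[a](subrK (unit_deg v)).
by apply: DS => //; apply: (@pr_ge0 _ _ _ _ S _ t); apply/eqP.
Qed.

Lemma in_deg_hom D a t : D a -> hdeg a t -> in_deg D t.
Proof. by move=> Da at_ b Db; rewrite (pr_hom _ at_); case: eqP => // ba; rewrite ba in Db. Qed.

Lemma in_deg_out D a t : ~ D a -> hdeg a t -> in_deg D t -> t = 0.
Proof. by move=> Da at_ /(_ a Da); rewrite at_. Qed.

Lemma in_deg_pr D a t : in_deg D t -> in_deg D (pr a t).
Proof.
by move=> tD b Db; rewrite pr_pr; case: eqP => // <-; apply: tD.
Qed.

Definition supp_gt k : Zdeg n -> Prop := fun a => (k < #|supp a|)%N.

Lemma supp_gt_stable k : stable_deg (supp_gt k).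
Proof.
move=> a v a0; rewrite /supp_gt supp_unitD //.
by move/leq_trans; apply; apply/subset_leq_card/subsetUr.
Qed.

(** The complex C_U(T) of the opening comment, up to the choice of signs. *)
Definition exact_at sg U j := forall c : {set 'I_n} -> T,
  (forall H, H \subset ~: U -> #|H| = j -> hdeg (set_deg H) (c H)) ->
  (forall H, H \subset ~: U -> #|H| = j.+1 -> kdiff x sg c H = 0) ->
  exists b : {set 'I_n} -> T,
    (forall H, H \subset ~: U -> #|H|.+1 = j -> hdeg (set_deg H) (b H)) /\
    (forall H, H \subset ~: U -> #|H| = j -> c H = kdiff x sg b H).

(** Rescaling the component of H by the product of the signs of its elements is an
    isomorphism between the two complexes. *)
Lemma exact_twist sg (tau : 'I_n -> bool) U j : exact_at sg U j ->
  exact_at (fun v H => sg v H (+) tau v) U j.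
Proof.
move=> ex c cH cd.
pose e H := odd #|[set u in H | tau u]|.
have eD H v : v \in H -> e (H :\ v) = e H (+) tau v.
  move=> vH; rewrite /e (cardsD1 v [set u in H | tau u]) oddD inE vH /=.
  have -> : [set u in H | tau u] :\ v = [set u in H :\ v | tau u].
    by apply/setP => u; rewrite !inE andbA.
  by case: (tau v) => /=; rewrite ?addbT ?negbK ?addbF.
have tw (b : {set 'I_n} -> T) H : kdiff x sg (fun G => (-1) ^+ e G *: b G) H =
    (-1) ^+ e H *: kdiff x (fun v H => sg v H (+) tau v) b H.
  rewrite scaler_sumr; apply: eq_bigr => v vH; rewrite !scalerA; congr (_ *: _).
  rewrite mulrAC -signr_addb eD // mulrA -signr_addb; congr (_ ^+ _ * _).
  by rewrite addbCA.
have [|H HU Hj|b [bH bE]] := ex (fun G => (-1) ^+ e G *: c G).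
- by move=> H HU Hj; apply/hom_sign/cH.
- by rewrite tw cd // scaler0.
exists (fun G => (-1) ^+ e G *: b G); split=> [H HU Hj|H HU Hj].
  exact/hom_sign/bH.
have : (-1) ^+ e H *: c H =
    (-1) ^+ e H *: kdiff x (fun v H => sg v H (+) tau v) (fun G => (-1) ^+ e G *: b G) H.
  rewrite bE // -tw; apply: kdiff_eq => v vH.
  by rewrite scalerA -signr_addb addbb expr0 scale1r.
move/(congr1 (fun t => (-1) ^+ e H *: t)).
by rewrite !scalerA -signr_addb addbb expr0 !scale1r.
Qed.

Lemma kdiff_eq_sign sg sg' (c : {set 'I_n} -> T) H : (forall v, v \in H -> sg v H = sg' v H) ->
  kdiff x sg c H = kdiff x sg' c H.
Proof. by move=> E; apply: eq_bigr => v vH; rewrite E. Qed.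

Lemma exact_eq sg sg' U j :
  (forall H v, H \subset ~: U -> v \in H -> sg v H = sg' v H) ->
  exact_at sg U j -> exact_at sg' U j.
Proof.
move=> E ex c cH cd; have [//||b [bH bE]] := ex c.
  by move=> H HU Hj; rewrite (kdiff_eq_sign (sg' := sg')) ?cd // => v; apply: E.
exists b; split=> // H HU Hj; rewrite bE //.
by apply: kdiff_eq_sign => v; apply: E.
Qed.

Definition ksign_over A v H := ksign v (H :|: A).

Lemma ksign_overE A v H : H \subset ~: A -> ksign_over A v H = ksign v H (+) ksign v A.
Proof.
move=> HA; rewrite /ksign_over /ksign -oddD -cardsUI.
have -> : [set u in H | (u < v)%N] :&: [set u in A | (u < v)%N] = set0.
  apply/setP => u; rewrite !inE; apply/negP => /andP[/andP[uH _] /andP[uA _]].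
  by have := subsetP HA u uH; rewrite inE uA.
rewrite cards0 addn0; congr (odd #|pred_of_set _|); apply/setP => u.
by rewrite !inE andb_orl.
Qed.

Lemma exact_overP A j : exact_at ksign A j <-> exact_at (ksign_over A) A j.
Proof.
split=> E; have := exact_twist (tau := ksign^~ A) E.
  by apply: exact_eq => H v HA _; rewrite ksign_overE.
by apply: exact_eq => H v HA _; rewrite ksign_overE // -addbA addbb addbF.
Qed.

(** The cochains that vanish off the sets containing A form the complex on the sets
    disjoint from A, with the sign inherited from H u A. *)
Lemma kdiff_over A (b : {set 'I_n} -> T) H : A \subset H -> (forall G, ~~ (A \subset G) -> b G = 0) ->
  d b H = kdiff x (ksign_over A) (fun G => b (G :|: A)) (H :\: A).
Proof.
move=> AH b0; rewrite /kdiff (bigID (mem A)) /= big1 ?add0r => [|v /andP[vH vA]].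
  apply: eq_big => [v|v /andP[vH vA]]; first by rewrite inE andbC.
  rewrite /ksign_over; congr (((-1) ^+ ksign v _ * _) *: b _).
    by apply/setP => u; rewrite !inE; case: (boolP (u \in A)) => [/(subsetP AH) ->|]; rewrite ?orbT ?orbF.
  apply/setP => u; rewrite !inE; case: (boolP (u \in A)) => [uA|_]; rewrite ?orbT ?orbF //.
  by rewrite (subsetP AH) // andbT; apply: contraNneq vA => <-.
rewrite b0 ?scaler0 //; apply/negP => /subsetP/(_ v vA).
by rewrite !inE eqxx.
Qed.

(** The complex on the sets disjoint from A is the part of the Koszul complex in the
    degree - set_deg A: there the component of G has degree set_deg G - set_deg A, which
    is nonnegative only if G contains A.  The position is shifted by #A. *)
Lemma kvanish_exact k A j : kvanish x (fun t : T => t = 0) k -> (j + #|A| < k)%N ->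
  exact_at ksign A j.
Proof.
move=> KV jk; apply/exact_overP => c cH cd.
pose C G := if (A \subset G) then c (G :\: A) else 0.
have C0 G : ~~ (A \subset G) -> C G = 0 by rewrite /C => /negPf ->.
have CU G : G \subset ~: A -> C (G :|: A) = c G.
  move=> GA; rewrite /C subsetUr setDUl setDv setU0; congr c.
  by apply/setDidPl; rewrite disjoints_subset.
have DA H : H :\: A \subset ~: A by apply/subsetP => u; rewrite !inE => /andP[].
have cardDA H : A \subset H -> #|H| = (#|H :\: A| + #|A|)%N.
  by move=> AH; rewrite -(cardsID A H) (setIidPr AH) addnC.
have [|B BE] := KV _ C jk.
  move=> H Hj; have [AH|AH] := boolP (A \subset H); last first.
    rewrite /kdiff big1 // => v vH; rewrite C0 ?scaler0 //.
    by apply: contraNN AH => /subset_trans; apply; apply: subD1set.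
  rewrite (kdiff_over AH C0) -[RHS](cd (H :\: A)) //; last first.
    by move: Hj; rewrite cardDA //; lia.
  apply: kdiff_eq => v _; apply: CU.
  exact: subset_trans (subD1set _ _) _.
have cardUA G : G \subset ~: A -> #|G :|: A| = (#|G| + #|A|)%N.
  move=> GA; rewrite cardsU (_ : G :&: A = set0) ?cards0 ?subn0 //.
  by apply/eqP; rewrite setI_eq0 disjoints_subset.
exists (fun G => pr (set_deg G) (B (G :|: A))); split=> [H _ _|H HA Hj].
  exact: hom_pr.
have := BE (H :|: A); rewrite cardUA // Hj CU // => /(_ erefl)/eqP.
rewrite subr_eq0 => /eqP E; have := cH H HA Hj; rewrite /hdeg E => {1}<-.
rewrite pr_bigsum /kdiff (bigID (mem A)) /= big1 ?add0r => [|v /andP[_ vA]].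
  apply: eq_big => [v|v /andP[vH vA]].
    rewrite !inE; case: (boolP (v \in A)) => vA; rewrite ?orbT ?orbF ?andbF ?andbT //.
    by apply/esym/negP => /(subsetP HA); rewrite inE vA.
  have {}vH : v \in H by move: vH; rewrite inE (negPf vA) orbF.
  rewrite -!scalerA pr_sign (set_degD1 vH) pr_var; congr (_ *: (_ *: pr _ (B _))).
  by rewrite setDUl; congr (_ :|: _); apply/setDidPl; rewrite disjoint_sym disjoints1.
rewrite -scalerA pr_sign pr_mulvar.
rewrite [pr _ (B _)](@hom_neg (set_deg H - unit_deg v) _ v) ?scaler0 //; first exact: hom_pr.
rewrite !ffunE eqxx; case: (boolP (v \in H)) => // /(subsetP HA).
by rewrite inE vA.
Qed.

End Sqmod.

(** * From exactness in squarefree degrees to Koszul vanishing *)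

Section ExactKoszul.
Variables (K : fieldType) (m n : nat) (T : lmodType {mpoly K[m]}) (S : sqmod n T).
Local Notation R := {mpoly K[m]}.
Local Notation x := (lvar K (emb S)).
Local Notation pr := (pr S).
Local Notation d := (kdiff x ksign).
Implicit Types (a : Zdeg n) (t u : T) (D : Zdeg n -> Prop).
Implicit Types (H G A U : {set 'I_n}) (v p : 'I_n).

(** In a degree a with a p > 0, multiplication by x_p is bijective between the components
    of G and p |: G, and its inverse is a contracting homotopy. *)
Lemma kvanish_deg_pos k j a p (c : {set 'I_n} -> T) :
  0 < a p -> (forall H, hdeg S (a + set_deg H) (c H)) ->
  (forall H, #|H| = j.+1 -> in_deg S (supp_gt k) (d c H)) ->
  exists b, (forall H, #|H| = j -> in_deg S (supp_gt k) (c H - d b H)).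
Proof.
move=> ap cH cd.
have As := in_deg_submod S (@supp_gt_stable n k).
have addp G : p \notin G -> a + set_deg (p |: G) = a + set_deg G + unit_deg p.
  by move=> pG; rewrite set_degU1 // addrA.
have posp G : 0 < (a + set_deg G) p by rewrite !ffunE; case: (p \in G) => /=; lia.
have /cochain_choice[b bP] : forall G, p \notin G -> exists y,
    hdeg S (a + set_deg G) y /\ x p *: y = (-1) ^+ ksign p (p |: G) *: c (p |: G).
  move=> G pG; have [|y yG yE] := @var_surj _ _ _ _ S (a + set_deg G) p
      ((-1) ^+ ksign p (p |: G) *: c (p |: G)) (posp G).
    by rewrite -addp //; apply: hom_sign.
  by exists y.
pose b0 G := if p \in G then 0 else b G.
have b0H G : hdeg S (a + set_deg G) (b0 G).
  by rewrite /b0; case: ifPn => [_|/bP[]//]; apply: hom0.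
exists b0 => H Hj; have [pH|pH] := boolP (p \in H).
  rewrite /kdiff (bigD1 p) //= big1 ?addr0 => [|v /andP[vH vp]]; last first.
    by rewrite /b0 !inE eq_sym vp pH scaler0.
  rewrite /b0 !inE eqxx /= -scalerA (bP (H :\ p) _).2 ?inE ?eqxx //.
  rewrite setD1K // scalerA -signr_addb addbb expr0 scale1r subrr.
  exact: submod0 As.
have yH : hdeg S (a + set_deg H) (c H - d b0 H).
  by apply: homB => //; apply: hom_kdiff.
have [Dy|Dy] := pselect (supp_gt k (a + set_deg H)); first exact: in_deg_hom yH.
suff -> : c H - d b0 H = 0 by apply: submod0.
apply: contrapT => y0; apply: (y0); apply: (var_inj (posp H) yH).
(* Since x_p is injective here, the identity can be checked after applying x_p. *)
have xyE : x p *: (c H - d b0 H) = (-1) ^+ ksign p H *: d c (p |: H).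
  rewrite /kdiff big_setU1 //= scalerBr scalerDr; congr (_ + _).
    by rewrite setU1K // ksign_self !scalerA mulrA -signr_addb addbb expr0 mul1r.
  rewrite !scaler_sumr -sumrN; apply: eq_bigr => v vH.
  have vp : v != p by apply: contraNneq pH => <-.
  have pHv : p \notin H :\ v by rewrite inE (negPf pH) andbF.
  rewrite /b0 (negPf pHv) !scalerA [x p * _]mulrC -[in LHS]scalerA (bP _ pHv).2 scalerA -scaleNr.
  have -> : (p |: H) :\ v = p |: (H :\ v).
    by apply/setP => w; rewrite !inE; case: (eqVneq w p) => [->|] //=; rewrite eq_sym vp.
  congr (_ *: _); rewrite ksign_self (ksignD1 _ vH) (ksignU1 _ pH).
  rewrite mulrAC -signr_addb -mulNr mulrA -signr_addb -signrN; congr (_ ^+ _ * _).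
  have [vp'|vp'|/val_inj/eqP] := ltngtP v p; last by rewrite (negPf vp).
    by case: ksign; case: ksign.
  by case: ksign; case: ksign.
have a0 := hom_nneg yH y0.
apply: (@in_deg_out _ _ _ _ S (supp_gt k) (a + set_deg H + unit_deg p)).
- rewrite /supp_gt supp_unitD //; apply: contra_not Dy; rewrite /supp_gt.
  rewrite (setUidPr _) // sub1set inE.
  by have := posp H; rewrite lt0r => /andP[].
- exact: hom_var.
rewrite xyE; apply: (submodZ _ As).
by apply: cd; rewrite cardsU1 pH Hj.
Qed.

(** With no positive entry, the Koszul complex is zero if some entry is less than -1, and
    otherwise a = - set_deg A and it is the complex on the sets disjoint from A. *)
Lemma kvanish_deg_npos k j a (c : {set 'I_n} -> T) :
  (j < k)%N -> (forall A i, (i + #|A| < k)%N -> exact_at S ksign A i) ->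
  (forall p, a p <= 0) -> (forall H, hdeg S (a + set_deg H) (c H)) ->
  (forall H, #|H| = j.+1 -> in_deg S (supp_gt k) (d c H)) ->
  exists b, (forall H, #|H| = j -> in_deg S (supp_gt k) (c H - d b H)).
Proof.
move=> jk ex a0 cH cd.
have As := in_deg_submod S (@supp_gt_stable n k).
have d0 H : d (fun=> 0 : T) H = 0 by apply: big1 => v _; rewrite scaler0.
suff [b bE] : exists b, forall H, #|H| = j -> c H = d b H.
  by exists b => H Hj; rewrite -bE // subrr; apply: submod0.
have [/existsP[v av]|/existsPn an] := boolP [exists v, a v < -1].
  exists (fun=> 0) => H _; rewrite d0; apply: (@hom_neg _ _ _ _ S _ _ v (cH H)).
  by rewrite !ffunE; case: (v \in H) => /=; lia.
pose A := [set v | a v == -1].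
have aE : a = - set_deg A.
  apply/ffunP => v; rewrite !ffunE inE.
  by have := an v; have := a0 v; case: (eqVneq (a v) (-1)) => /=; lia.
have cA G : ~~ (A \subset G) -> c G = 0.
  case/subsetPn => v vA vG; apply: (@hom_neg _ _ _ _ S _ _ v (cH G)).
  by rewrite aE !ffunE vA (negPf vG).
have [jA|jA] := ltnP j #|A|.
  exists (fun=> 0) => H Hj; rewrite d0; apply: cA; apply: contraL jA => /subset_leq_card.
  by rewrite Hj -leqNgt.
have degU G : G \subset ~: A -> a + set_deg (G :|: A) = set_deg G.
  move=> GA; rewrite aE; apply/ffunP => v; rewrite !ffunE in_setU.
  have := subsetP GA v; rewrite in_setC.
  by case: (v \in G) => [/(_ isT)/negPf ->|_] /=; rewrite ?oppr0 ?add0r ?addNr.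
have cardU G : G \subset ~: A -> #|G :|: A| = (#|G| + #|A|)%N.
  move=> GA; rewrite cardsU (_ : G :&: A = set0) ?cards0 ?subn0 //.
  by apply/eqP; rewrite setI_eq0 disjoints_subset.
have DU G : G \subset ~: A -> (G :|: A) :\: A = G.
  by move=> GA; rewrite setDUl setDv setU0; apply/setDidPl; rewrite disjoints_subset.
have [|G GA Gj|G GA Gj|b [bH bE]] := (exact_overP S A (j - #|A|)).1 _ (fun G => c (G :|: A)).
- by apply: ex; rewrite subnK.
- by rewrite /hdeg -degU //; apply: cH.
- rewrite -[X in kdiff _ _ _ X](DU G GA) -(kdiff_over S) ?subsetUr //.
  apply: (@in_deg_out _ _ _ _ S (supp_gt k) (set_deg G)).
  + by rewrite /supp_gt supp_set_deg Gj; move: jA jk; clear; lia.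
  + by rewrite -degU //; apply: hom_kdiff.
  + by apply: cd; rewrite cardU // Gj addSn subnK.
exists (fun G => if A \subset G then b (G :\: A) else 0) => H Hj.
have [AH|AH] := boolP (A \subset H); last first.
  rewrite cA // /kdiff big1 // => v vH; case: ifPn; rewrite ?scaler0 //.
  by move=> /subset_trans/(_ (subD1set _ _)); rewrite (negPf AH).
have HA : H :\: A \subset ~: A by apply/subsetP => u; rewrite !inE => /andP[].
rewrite (kdiff_over S AH) => [|G /negPf -> //].
have -> : c H = c ((H :\: A) :|: A) by rewrite setUC -[X in X :|: _](setIidPr AH) setID.
rewrite bE ?DU //; last by rewrite cardsD (setIidPr AH) Hj.
apply: kdiff_eq => v _; rewrite subsetUr DU //.
exact: subset_trans (subD1set _ _) _.
Qed.

(** A cochain is the sum of its finitely many homogeneous parts, which are treated one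
    by one. *)
Lemma exact_kvanish k : (forall A i, (i + #|A| < k)%N -> exact_at S ksign A i) ->
  kvanish x (in_deg S (supp_gt k)) k.
Proof.
move=> ex j c jk cd; have As := in_deg_submod S (@supp_gt_stable n k).
have /choice[s sP] H := pr_support S (c H).
pose L := undup (flatten [seq [seq a - set_deg H | a <- s H] | H <- enum {set 'I_n}]).
have cE H : c H = \sum_(a <- L) pr (a + set_deg H) (c H).
  rewrite [LHS](sP H [seq a + set_deg H | a <- L]) ?big_map //.
    rewrite map_inj_uniq ?undup_uniq //; exact: addIr.
  move=> a sa; apply/mapP; exists (a - set_deg H); last by rewrite subrK.
  rewrite mem_undup; apply/flattenP; exists [seq a - set_deg H | a <- s H].
    by apply/mapP; exists H => //; rewrite mem_enum.
  by apply/mapP; exists a.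
have /choice[b bP] a : exists b, forall H, #|H| = j ->
    in_deg S (supp_gt k) (pr (a + set_deg H) (c H) - d b H).
  have hc H : hdeg S (a + set_deg H) (pr (a + set_deg H) (c H)) by apply: hom_pr.
  have dc H : #|H| = j.+1 ->
      in_deg S (supp_gt k) (d (fun G => pr (a + set_deg G) (c G)) H).
    by move=> Hj; rewrite -pr_kdiff; apply/in_deg_pr/cd.
  have [/existsP[p ap]|/existsPn ap] := boolP [exists p, 0 < a p].
    exact: kvanish_deg_pos ap hc dc.
  by apply: kvanish_deg_npos => // p; rewrite leNgt.
exists (fun H => \sum_(a <- L) b a H) => H Hj.
rewrite cE kdiff_sum -sumrB; apply: submod_sum => // a _; exact: bP.
Qed.

End ExactKoszul.

(** * Elementary symmetric polynomials as a regular sequence *)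

Section ElementarySymmetric.
Variables (K : fieldType) (m n : nat) (T : lmodType {mpoly K[m]}) (S : sqmod n T).
Local Notation R := {mpoly K[m]}.
Local Notation x := (lvar K (emb S)).
Local Notation pr := (pr S).
Implicit Types (a : Zdeg n) (t u : T) (D : Zdeg n -> Prop) (A C : T -> Prop).
Implicit Types (F H G : {set 'I_n}) (v p : 'I_n) (k : nat) (e : int) (s : seq R).

Definition tdeg a : int := \sum_i a i.

Lemma tdeg_unit a v : tdeg (a + unit_deg v) = tdeg a + 1.
Proof.
rewrite /tdeg; under eq_bigr do rewrite ffunE; rewrite big_split /=; congr (_ + _).
rewrite (bigD1 v) //= ffunE eqxx big1 ?addr0 // => i /negPf iv.
by rewrite ffunE iv.
Qed.

Lemma tpr_ex e t : exists u, forall a, pr a u = if tdeg a == e then pr a t else 0.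
Proof.
have [s us tE] := pr_fin S t; exists (\sum_(a <- s | tdeg a == e) pr a t) => a.
rewrite [in RHS]tE !pr_bigsum; case: ifPn => [ae|ae].
  rewrite [RHS](bigID (fun b => tdeg b == e)) /= [X in _ = _ + X]big1 ?addr0 // => b be.
  by rewrite pr_pr; case: eqP => // ab; rewrite -ab ae in be.
rewrite big1 // => b be; rewrite pr_pr; case: eqP => // ab.
by rewrite -ab (negPf ae) in be.
Qed.

(** The part of total degree e: the elementary symmetric polynomials are homogeneous for
    the total degree only. *)
Definition tpr e t : T := projT1 (cid (tpr_ex e t)).

Lemma pr_tpr a e t : pr a (tpr e t) = if tdeg a == e then pr a t else 0.
Proof. by rewrite /tpr; case: cid. Qed.

Lemma pr_eq t u : (forall a, pr a t = pr a u) -> t = u.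
Proof.
move=> E; apply/eqP; rewrite -subr_eq0; apply/eqP/(@pr_ext _ _ _ _ S) => a.
by rewrite prB E subrr.
Qed.

Lemma tprD e t u : tpr e (t + u) = tpr e t + tpr e u.
Proof. by apply: pr_eq => a; rewrite prD !pr_tpr prD; case: ifP; rewrite ?addr0. Qed.

Lemma tpr0 e : tpr e 0 = 0.
Proof. by apply: pr_eq => a; rewrite pr_tpr pr0 if_same. Qed.

Lemma tpr_bigsum e (I : Type) (r : seq I) (P : pred I) (E : I -> T) :
  tpr e (\sum_(i <- r | P i) E i) = \sum_(i <- r | P i) tpr e (E i).
Proof. by apply: (big_morph _ (tprD e) (tpr0 e)). Qed.

Lemma tpr_neg e t : e < 0 -> tpr e t = 0.
Proof.
move=> e0; apply: (@pr_ext _ _ _ _ S) => a; rewrite pr_tpr; case: eqP => // ae.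
apply: contrapT => /(@pr_ge0 _ _ _ _ S a t) a0; move: e0; rewrite -ae ltNge sumr_ge0 //.
Qed.

Lemma tpr_var e v t : tpr e (x v *: t) = x v *: tpr (e - 1) t.
Proof.
apply: pr_eq => a; rewrite pr_tpr !pr_mulvar pr_tpr.
have -> : (tdeg (a - unit_deg v) == e - 1) = (tdeg a == e).
  by rewrite -[in RHS](subrK (unit_deg v) a) tdeg_unit -(inj_eq (addIr 1)) subrK.
by case: ifP; rewrite ?scaler0.
Qed.

Lemma tpr_in A t : submod A -> (forall e, A (tpr e t)) -> A t.
Proof.
move=> As At; have [s us tE] := pr_fin S t.
have -> : t = \sum_(e <- undup [seq tdeg a | a <- s]) tpr e t.
  apply: pr_eq => a; rewrite pr_bigsum.
  have [as_|as_] := boolP (a \in s).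
    rewrite (bigD1_seq (tdeg a)) ?undup_uniq ?mem_undup ?map_f //= pr_tpr eqxx.
    by rewrite big1 ?addr0 // => e /negPf; rewrite pr_tpr eq_sym => ->.
  have a0 : pr a t = 0.
    rewrite tE pr_bigsum big_seq big1 // => b bs; rewrite pr_pr.
    by case: eqP => // ab; rewrite ab bs in as_.
  by rewrite a0 big1 // => e _; rewrite pr_tpr a0 if_same.
exact: submod_sum.
Qed.

Definition tgraded A := forall e t, A t -> A (tpr e t).

Definition tmul (f : R) := exists k : int, forall e t, tpr e (f *: t) = f *: tpr (e - k) t.

Lemma tgraded_addmul C A f : submod C -> tgraded C -> tgraded A -> tmul f ->
  tgraded (addmul C f A).
Proof.
move=> Cs Cg Ag [k fk] e _ [y [w [Cy Aw ->]]].
by exists (tpr (e - k) y), (tpr e w); rewrite tprD fk; split=> //; [apply: Cg|apply: Ag].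
Qed.

Lemma tgraded_in_deg D : tgraded (in_deg S D).
Proof. by move=> e t tD a Da; rewrite pr_tpr tD // if_same. Qed.

Lemma addmulC C f g A : addmul C f (addmul C g A) = addmul C g (addmul C f A).
Proof.
have sub f' g' z : addmul C f' (addmul C g' A) z -> addmul C g' (addmul C f' A) z.
  move=> [y [_ [Cy [y' [w [Cy' Aw ->]]] ->]]]; exists y', (f' *: y + w).
  by split=> //; [exists y, w|rewrite addrCA].
by apply/funext => z; apply/propext; split; apply: sub.
Qed.

(** If x_v, s is regular on C/A then so is s, x_v.  In general this fails; here, f z in A
    makes z divisible by x_v modulo A with a quotient of smaller total degree that
    satisfies the same condition, so that z is in A by induction on the degree. *)
Lemma reg_perm C A v s : submod C -> submod A -> tgraded C -> tgraded A ->
  (forall f, f \in s -> tmul f) -> nonzerodiv C (x v) A -> reg C s (addmul C (x v) A) ->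
  reg C s A /\ nonzerodiv C (x v) (adds C s A).
Proof.
move=> Cs + Cg; elim: s A => //= f s IH A As Ag sm xA [fxA sxA].
have fm := sm f (mem_head _ _).
have fA : nonzerodiv C f A.
  (* Induction on a strict bound N for the degree of the part considered. *)
  suff H N : forall z, C z -> A (f *: z) -> forall e, e < N%:Z -> A (tpr e z).
    by move=> z Cz Afz; apply: tpr_in => // e; apply: (H `|e|.+1) => //; lia.
  elim: N => [|N IHN] z Cz Afz e eN; first by rewrite tpr_neg //; apply: submod0.
  have [y [w [Cy Aw zE]]] := fxA z Cz (addmulW (x v) Cs Afz).
  rewrite zE tprD tpr_var; apply: submodD => //; last exact: Ag.
  apply: submodZ => //; apply: IHN => //; last by lia.
  apply: xA; first exact: submodZ.
  have -> : x v *: (f *: y) = f *: z - f *: w.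
    by rewrite zE scalerDr addrK !scalerA mulrC.
  by apply: submodB => //; apply: submodZ.
have xfA : nonzerodiv C (x v) (addmul C f A).
  move=> z Cz [y [w [Cy Aw E]]].
  have [|y' [w' [Cy' Aw' yE]]] := fxA y Cy.
    exists z, (- w); split=> //; first exact: submodN.
    by rewrite E addrK.
  have Azf : A (z - f *: y').
    apply: xA; first by apply: submodB => //; apply: submodZ.
    have -> : x v *: (z - f *: y') = f *: w' + w.
      rewrite scalerBr E yE scalerDr !scalerA [x v * f]mulrC.
      by rewrite -addrA addrC addrA subrK addrC.
    by apply: submodD => //; apply: submodZ.
  by exists y', (z - f *: y'); split; rewrite // addrC subrK.
have [|||||sr xr] := IH (addmul C f A).
- exact: addmul_submod.
- exact: tgraded_addmul.
- by move=> g gs; apply: sm; rewrite inE gs orbT.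
- exact: xfA.
- by rewrite addmulC.
by [].
Qed.

Lemma prod_tpr (l : seq 'I_n) e t :
  tpr e ((\prod_(v <- l) x v) *: t) = (\prod_(v <- l) x v) *: tpr (e - (size l)%:Z) t.
Proof.
elim: l e => [|v l IH] e; first by rewrite big_nil !scale1r subr0.
by rewrite big_cons -!scalerA tpr_var IH; congr (_ *: (_ *: tpr _ _)) => /=; lia.
Qed.

Definition elsym k : R := \sum_(F : {set 'I_n} | #|F| == k) \prod_(v in F) x v.

Definition elsyms k : seq R := [seq elsym j | j <- iota 1 k].

Lemma size_elsyms k : size (elsyms k) = k.
Proof. by rewrite size_map size_iota. Qed.

Lemma elsymsS k : elsyms k.+1 = elsyms k ++ [:: elsym k.+1].
Proof. by rewrite /elsyms -{1}(addn1 k) iotaD map_cat add1n. Qed.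

Lemma tmul_elsym k : tmul (elsym k).
Proof.
exists k%:Z => e t; rewrite !scaler_suml tpr_bigsum; apply: eq_bigr => F /eqP <-.
by rewrite -big_enum prod_tpr cardE.
Qed.

Lemma tmul_elsyms k f : f \in elsyms k -> tmul f.
Proof. by case/mapP => j _ ->; apply: tmul_elsym. Qed.

Lemma in_deg_var D D' v t : (forall a, nneg_deg a -> D a -> D' (a + unit_deg v)) ->
  in_deg S D t -> in_deg S D' (x v *: t).
Proof.
move=> DD tD a Da; rewrite pr_mulvar.
have [->|/eqP t0] := eqVneq (pr (a - unit_deg v) t) 0; first by rewrite scaler0.
rewrite tD ?scaler0 // => Dav; apply: Da; rewrite -[a](subrK (unit_deg v)).
by apply: DD => //; apply: pr_ge0 t0.
Qed.

Lemma in_degS D D' t : (forall a, D a -> D' a) -> in_deg S D t -> in_deg S D' t.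
Proof. by move=> DD tD a Da; apply: tD => /DD. Qed.

Definition fam (P : {set {set 'I_n}}) : Zdeg n -> Prop := fun a => supp a \in P.

Definition upclosed (P : {set {set 'I_n}}) := forall F v, F \in P -> v |: F \in P.

Lemma fam_stable P : upclosed P -> stable_deg (fam P).
Proof. by move=> Pu a v a0 Pa; rewrite /fam supp_unitD //; apply: Pu. Qed.

(** Here C / A is zero. *)
Lemma reg_triv C A s : submod C -> (forall z, C z -> A z) -> reg C s A.
Proof.
move=> Cs; elim: s A => //= f s IH A CA; split; first by move=> z /CA.
by apply: IH => z /CA; apply: addmulW.
Qed.

(** Let F be a set all of whose proper supersets lie in the up-closed family P.  The
    quotient of the submodules for F |: P and P is a sum of copies of the polynomial ring
    in the variables of F, up to a shift. *)
Section OneFace.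
Variables (P : {set {set 'I_n}}) (F : {set 'I_n}).
Hypotheses (Pu : upclosed P) (FP : F \notin P) (PF : forall v, v \notin F -> v |: F \in P).

Let P1 := F |: P.
Let C := in_deg S (fam P1).

Lemma face_upclosed : upclosed P1.
Proof.
move=> G v; rewrite !in_setU1 => /orP[/eqP ->|/Pu ->]; last by rewrite orbT.
have [vF|/PF ->] := boolP (v \in F); last by rewrite orbT.
by rewrite (setUidPr _) ?eqxx // sub1set.
Qed.

Let Cs : submod C.
Proof. exact/in_deg_submod/fam_stable/face_upclosed. Qed.

(** The submodule of these degrees is generated, modulo that of P, by the x_u C with u in
    F and not in G; the quotient is a polynomial ring in the variables of G. *)
Definition face_deg G a :=
  supp a \in P \/ supp a = F /\ exists2 u, (u \in F) && (u \notin G) & 2%:Z <= a u.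

Lemma face_deg_stable G : stable_deg (face_deg G).
Proof.
move=> a v a0 [aP|[aF [u uG au]]]; first by left; rewrite supp_unitD //; apply: Pu.
have [vF|vF] := boolP (v \in F); last by left; rewrite supp_unitD // aF; apply: PF.
right; split; first by rewrite supp_unitD // aF (setUidPr _) // sub1set.
by exists u => //; rewrite !ffunE; case: (u == v) => /=; lia.
Qed.

Let As G : submod (in_deg S (face_deg G)).
Proof. exact/in_deg_submod/face_deg_stable. Qed.

Lemma face_kill G v z : v \notin G -> C z -> in_deg S (face_deg G) (x v *: z).
Proof.
move=> vG; apply: in_deg_var => a a0; rewrite /fam in_setU1 => /orP[/eqP aF|aP]; last first.
  by left; rewrite supp_unitD //; apply: Pu.
have [vF|vF] := boolP (v \in F); last by left; rewrite supp_unitD // aF; apply: PF.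
right; split; first by rewrite supp_unitD // aF (setUidPr _) // sub1set.
exists v; rewrite ?vF // !ffunE eqxx /=.
by move: vF; rewrite -aF inE; have := a0 v; lia.
Qed.

Lemma face_nzd G v : G \subset F -> v \in G -> nonzerodiv C (x v) (in_deg S (face_deg G)).
Proof.
move=> GF vG z Cz xz a Da; apply: contrapT => az0.
have a0 := @pr_ge0 _ _ _ _ S _ _ az0.
have vF := subsetP GF v vG.
have aF : supp a = F.
  apply: contrapT => aF; apply: az0; apply: Cz; rewrite /fam in_setU1 => /orP[/eqP //|aP].
  by apply: Da; left.
have av : 0 < a v by move: vF; rewrite -aF inE; have := a0 v; lia.
apply: az0; apply: (var_inj av); first exact: hom_pr.
rewrite -pr_var; apply: xz => -[|[_ [u /andP[uF uG]]]].
  by rewrite supp_unitD // aF (setUidPr _) ?sub1set // (negPf FP).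
rewrite !ffunE; case: eqP => [uv|_]; first by rewrite uv vG in uG.
by rewrite addr0 => au; apply: Da; right; split=> //; exists u; rewrite ?uF.
Qed.

Lemma face_addmul G v : G \subset F -> v \in G ->
  addmul C (x v) (in_deg S (face_deg G)) = in_deg S (face_deg (G :\ v)).
Proof.
move=> GF vG; have vF := subsetP GF v vG.
apply/funext => z; apply/propext; split.
  move=> [y [w [Cy Aw ->]]]; apply: (submodD (As (G :\ v))).
    by apply: face_kill; rewrite // !inE eqxx.
  apply: in_degS Aw => a [aP|[aF [u /andP[uF uG] au]]]; [by left|right; split=> //].
  by exists u => //; rewrite uF !inE (negPf uG) andbF.
move=> zD; have [s us ->] := pr_fin S z.
have As' : submod (addmul C (x v) (in_deg S (face_deg G))) by apply: addmul_submod; [exact: Cs|exact: As].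
apply: submod_sum => // a _.
have [Da|Da] := pselect (face_deg G a).
  by apply: addmulW; [exact: Cs|apply: in_deg_hom Da _; exact: hom_pr].
have [->|/eqP az0] := eqVneq (pr a z) 0; first exact: submod0.
have a0 := @pr_ge0 _ _ _ _ S _ _ az0.
have [aP|[aF [u /andP[uF uG] au]]] : face_deg (G :\ v) a.
    by apply: contrapT => /zD.
  by case: Da; left.
have uv : u = v.
  apply/eqP/negPn/negP => uv; apply: Da; right; split=> //; exists u => //.
  by rewrite uF; apply: contra uG; rewrite !inE uv.
rewrite {u uF uG}uv in au.
have [||y yh ->] := @var_surj _ _ _ _ S (a - unit_deg v) v (pr a z).
- by rewrite !ffunE eqxx /=; move: au; lia.
- by rewrite subrK; apply: hom_pr.
apply: addmulM; first exact: As.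
apply: in_deg_hom yh; rewrite /fam in_setU1; apply/orP; left; apply/eqP.
rewrite -aF; apply/setP => w; rewrite !inE !ffunE.
by case: (eqVneq w v) => [->|_]; rewrite ?subr0 //=; lia.
Qed.

(** For v in G the quotient by x_v is the polynomial ring in the variables of G :\ v, on
    which e_1, ..., e_{k-1} is regular by induction; [reg_perm] moves x_v to the end.  So
    every x_v with v in G is a nonzerodivisor on the quotient by e_1, ..., e_{k-1}, and
    hence so is their product, which is e_k there. *)
Lemma face_reg G : G \subset F -> reg C (elsyms #|G|) (in_deg S (face_deg G)).
Proof.
elim: {G}#|G| {-2}G (erefl #|G|) => [|k IH] G Gk GF; first by rewrite Gk.
have Gn v : v \in G -> reg C (elsyms k) (in_deg S (face_deg G)) /\
    nonzerodiv C (x v) (adds C (elsyms k) (in_deg S (face_deg G))).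
  move=> vG; apply: reg_perm; [exact: Cs|exact: As| | | | |].
  - exact: tgraded_in_deg.
  - exact: tgraded_in_deg.
  - exact: tmul_elsyms.
  - exact: face_nzd.
  have Ek : #|G :\ v| = k by move: Gk; rewrite (cardsD1 v) vG => -[].
  rewrite face_addmul // -Ek; apply: IH => //.
  exact: subset_trans (subD1set _ _) GF.
have /card_gt0P[v0 v0G] : (0 < #|G|)%N by rewrite Gk.
rewrite Gk elsymsS; apply/reg_cat; split; first by case: (Gn v0 v0G).
split=> //; set A := adds _ _ _ in Gn *.
have As' : submod A by apply: adds_submod; [exact: Cs|exact: As].
move=> z Cz Az.
have {}Az : A ((\prod_(v <- enum G) x v) *: z).
  rewrite big_enum; move: Az; rewrite /elsym (bigD1 G) ?Gk //= scalerDl => Az.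
  rewrite -[_ *: _](addrK ((\sum_(H : {set 'I_n} | (#|H| == k.+1) && (H != G)) \prod_(v in H) x v) *: z)).
  apply: submodB => //; rewrite scaler_suml; apply: submod_sum => // H /andP[/eqP Hk HG].
  have [u uH uG] : exists2 u, u \in H & u \notin G.
    apply/subsetPn; apply: contra HG => HG; rewrite eqEcard HG.
    by rewrite Gk Hk leqnn.
  rewrite (bigD1 u) //= mulrC -scalerA; apply: submodZ => //.
  by apply: addsW; [exact: Cs|exact: face_kill].
have : {subset enum G <= G} by move=> v; rewrite mem_enum.
elim: (enum G) Az => [|v l IHl]; first by rewrite big_nil scale1r.
rewrite big_cons -scalerA => Az lG; apply: IHl => [|w wl]; last first.
  by apply: lG; rewrite inE wl orbT.
have [_ vA] := Gn v (lG v (mem_head _ _)); apply: vA => //.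
exact: (submodZ _ Cs).
Qed.

Lemma one_face_reg k : (k <= #|F|)%N -> reg C (elsyms k) (in_deg S (fam P)).
Proof.
move=> kF; have := face_reg (subxx F).
have -> : face_deg F = fam P.
  apply/funext => a; apply/propext; split; last by left.
  by move=> [//|[_ [u /andP[uF]]]]; rewrite uF.
have -> : elsyms #|F| = elsyms k ++ [seq elsym j | j <- iota k.+1 (#|F| - k)].
  by rewrite /elsyms -map_cat -add1n -iotaD subnKC.
by move=> /reg_cat[].
Qed.

End OneFace.

(** The sets of P' outside P are added one at a time, by decreasing size. *)
Lemma reg_fam k (P P' : {set {set 'I_n}}) : upclosed P -> upclosed P' -> P \subset P' ->
  (forall F, F \in P' :\: P -> (k <= #|F|)%N) ->
  reg (in_deg S (fam P')) (elsyms k) (in_deg S (fam P)).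
Proof.
elim: {P}#|P' :\: P| {-2}P (erefl #|P' :\: P|) => [|N IH] P PN Pu Pu' PP Pk.
  apply: reg_triv; first exact/in_deg_submod/fam_stable.
  have -> : P = P' by apply/eqP; rewrite eqEsubset PP -setD_eq0 (cards0_eq PN) eqxx.
  by [].
have /card_gt0P[F0 F0P] : (0 < #|P' :\: P|)%N by rewrite PN.
have [F FP Fmax] := @arg_maxnP _ F0 (mem (P' :\: P)) (fun F => #|F|) F0P.
have FPm : F \in P' :\: P := FP.
have FP' : (F \notin P) && (F \in P') by move: FP; rewrite /= inE.
have PF v : v \notin F -> v |: F \in P.
  move=> vF; apply: contraT => vP; have := Fmax (v |: F); rewrite /= inE vP.
  rewrite Pu' ?(andP FP').2 // => /(_ isT).
  by rewrite cardsU1 vF add1n ltnn.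
have [FnP FiP'] := andP FP'.
have P1u := face_upclosed Pu PF.
apply: (@reg_ses _ _ _ (in_deg S (fam (F |: P))) (in_deg S (fam P)) _ _ (in_deg S (fam (F |: P)))).
- exact/in_deg_submod/fam_stable.
- exact/in_deg_submod/fam_stable.
- exact/in_deg_submod/fam_stable.
- exact/in_deg_submod/fam_stable.
- move=> z; apply: in_degS => a; rewrite /fam in_setU1 => /orP[/eqP -> //|].
  exact: (subsetP PP).
- by [].
- by [].
- move=> z; split=> [zP|[b [a [bP aP ->]]]].
    by exists z, 0; rewrite addr0; split=> //; exact: submod0 (in_deg_submod S (fam_stable Pu)).
  apply: (submodD (in_deg_submod S (fam_stable P1u))) => //.
  by apply: in_degS aP => c; rewrite /fam in_setU1 => ->; rewrite orbT.
- by apply: one_face_reg => //; apply: Pk.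
apply: IH => //.
- move: PN; rewrite (cardsD1 F) FPm => -[<-]; congr (#|pred_of_set _|).
  by apply/setP => G; rewrite !inE negb_or andbA.
- by apply/subsetP => G; rewrite in_setU1 => /orP[/eqP -> //|]; apply: (subsetP PP).
- by move=> G; rewrite !inE negb_or => /andP[/andP[_ GP] GP']; apply: Pk; rewrite inE GP.
Qed.

Lemma prod_supp (l : seq 'I_n) t :
  in_deg S (fun a => {subset l <= supp a}) ((\prod_(v <- l) x v) *: t).
Proof.
elim: l => [|v l IH]; first by move=> a /(_ (fun _ => _))[].
rewrite big_cons -scalerA; apply: in_deg_var IH => a a0 la w.
by rewrite supp_unitD // in_setU1 inE => /orP[->//|/la ->]; rewrite orbT.
Qed.

Lemma elsym_above k t : in_deg S (supp_gt k) (elsym k.+1 *: t).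
Proof.
rewrite scaler_suml; have As := in_deg_submod S (@supp_gt_stable n k).
apply: (@submod_sum _ _ (in_deg S (supp_gt k)) _ _ _ _ As).
move=> F /eqP Fk; have -> : \prod_(v in F) x v = \prod_(v <- enum F) x v by rewrite big_enum.
apply: in_degS (prod_supp (l := enum F) t) => a Fa.
rewrite /supp_gt -Fk; apply/subset_leq_card/subsetP => v vF.
by apply: Fa; rewrite mem_enum.
Qed.

Lemma supp_gt_le k j t : (j <= k)%N -> in_deg S (supp_gt k) t -> in_deg S (supp_gt j) t.
Proof. by move=> jk; apply: in_degS => a; apply: leq_ltn_trans. Qed.

(** Expand the product of all x_u - x_v, which is 0 as it has the factor for u = v. *)
Lemma elsym_newton v : x v ^+ n = \sum_(1 <= k < n.+1) (- (-1) ^+ k * x v ^+ (n - k)) * elsym k.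
Proof.
have : \prod_u (x u + - x v) = 0 by rewrite (bigD1 v) //= subrr mul0r.
rewrite bigA_distr.
have -> : \sum_(J : {set 'I_n}) \prod_i (if i \in J then x i else - x v) =
    \sum_(J : {set 'I_n}) (- x v) ^+ (n - #|J|) * \prod_(i in J) x i.
  apply: eq_bigr => J _; rewrite (bigID (mem J)) /= mulrC; congr (_ * _).
    rewrite (eq_bigr (fun=> - x v)) => [|i /negPf -> //].
    rewrite prodr_const; congr (_ ^+ _).
    by rewrite -[X in (X - _)%N]card_ord -(cardC J) addKn; apply: eq_card => i; rewrite !inE.
  by apply: eq_bigr => i ->.
rewrite (partition_big (fun J : {set 'I_n} => inord #|J| : 'I_n.+1) xpredT) //=.
have Jn (J : {set 'I_n}) : (#|J| < n.+1)%N by rewrite ltnS -[X in (_ <= X)%N]card_ord max_card.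
have -> : \sum_(k < n.+1) \sum_(J : {set 'I_n} | inord #|J| == k)
      (- x v) ^+ (n - #|J|) * \prod_(i in J) x i =
    \sum_(k < n.+1) (- x v) ^+ (n - k) * elsym k.
  apply: eq_bigr => k _; rewrite mulr_sumr; apply: eq_big => J.
    by rewrite -val_eqE /= inordK.
  by move=> /eqP <-; rewrite inordK.
rewrite -(big_mkord xpredT (fun k => (- x v) ^+ (n - k) * elsym k)) big_ltn // subn0.
have -> : elsym 0 = 1.
  rewrite /elsym (big_pred1 set0) ?big_set0 // => J.
  by rewrite cards_eq0.
rewrite mulr1 => /eqP; rewrite addr_eq0 => /eqP E.
have <- : (-1) ^+ n * (- x v) ^+ n = x v ^+ n.
  by rewrite -exprMn mulN1r opprK.
rewrite E -sumrN mulr_sumr [LHS]big_nat [RHS]big_nat; apply: eq_bigr => k /andP[_ kn].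
have -> : (-1) ^+ n = (-1) ^+ k * (-1) ^+ (n - k) :> R by rewrite -exprD subnKC.
rewrite -[- x v]mulN1r exprMn.
have : (-1) ^+ (n - k) * (-1) ^+ (n - k) = 1 :> R by rewrite -exprD addnn -mul2n exprM sqrrN expr1n expr1n.
move: ((-1) ^+ (n - k)) => y; move: ((-1) ^+ k) => z yy.
transitivity (- ((y * y) * (z * x v ^+ (n - k) * elsym k))); first by ring.
by rewrite yy; ring.
Qed.

(** The induction step of the regularity of e_1, ..., e_k: the first k - 1 elements are
    handled by [reg_ses] and [reg_fam], the last one by the absence of nonzero elements
    killed by all the variables. *)
Lemma elsyms_reg k : (forall j, (j <= k)%N -> kvanish x (in_deg S (supp_gt j)) j) ->
  reg (fun=> True) (elsyms k) (in_deg S (supp_gt k)).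
Proof.
elim: k => [//|k IH] KV.
have As := in_deg_submod S (@supp_gt_stable n k.+1).
have As0 := in_deg_submod S (@supp_gt_stable n k).
have supp_gtE j : supp_gt j = fam [set G : {set 'I_n} | (j < #|G|)%N].
  by apply/funext => a; rewrite /fam inE.
have reg1 : reg (fun=> True) (elsyms k) (in_deg S (supp_gt k.+1)).
  apply: (@reg_ses _ _ _ (in_deg S (supp_gt k)) (in_deg S (supp_gt k.+1)) _ _ (in_deg S (supp_gt k))) => //.
  - move=> z; split=> [zP|[b [a [bP /(supp_gt_le (leqnSn k)) aP ->]]]].
      by exists z, 0; rewrite addr0; split=> //; apply: submod0.
    exact: (submodD As0).
  - rewrite !supp_gtE; apply: reg_fam.
    + by move=> F v; rewrite !inE => /leq_trans; apply; apply/subset_leq_card/subsetUr.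
    + by move=> F v; rewrite !inE => /leq_trans; apply; apply/subset_leq_card/subsetUr.
    + by apply/subsetP => F; rewrite !inE; apply: ltnW.
    + by move=> F; rewrite !inE => /andP[_ /ltnW].
  - by apply: IH => j jk; apply: KV; apply: leqW.
rewrite elsymsS; apply/reg_cat; split=> //; split=> //; set A := adds _ _ _.
have As' : submod A by apply: adds_submod.
(* Vanishing in position 0, left over after dividing by k elements. *)
have soc z : (forall v, A (x v *: z)) -> A z.
  have KV1 : kvanish x A 1.
    by apply: kvanish_adds => //; rewrite size_elsyms addn1; apply: KV.
  move=> zA; have [||b bA] := KV1 0%N (fun=> z).
  - by [].
  - by move=> H _; apply: submod_sum => // v _; rewrite -scalerA; apply: (submodZ _ As'); apply: zA.
  - have := bA set0 (cards0 _); rewrite /kdiff big1 ?subr0 // => v.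
    by rewrite inE.
move=> z _ zA.
have xA v : A (x v ^+ n *: z).
  rewrite elsym_newton scaler_suml big_nat; apply: submod_sum => // j /andP[j0 jn].
  rewrite -scalerA; apply: submodZ => //.
  have [jk|kj|->//] := ltngtP j k.+1.
    by apply: adds_mem => //; apply/mapP; exists j => //; rewrite mem_iota j0 add1n.
  apply: addsW => //; case: j kj {j0 jn} => // j kj.
  have {}kj : (k.+1 <= j)%N := kj; exact: (supp_gt_le kj (elsym_above (k := j) z)).
(* An element killed by x_v ^ (q v) for all v is zero: each x_v z satisfies the same with a
   smaller sum of exponents. *)
suff H N : forall (q : 'I_n -> nat) z, (\sum_v q v <= N)%N ->
    (forall v, A (x v ^+ q v *: z)) -> A z.
  exact: (H _ (fun=> n) z (leqnn _)).
elim: N => [|N IHN] q {zA xA}z qN qA; apply: soc => v.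
  have := qA v; move: qN; rewrite leqn0 sum_nat_eq0 => /forallP/(_ v)/= /eqP ->.
  by rewrite expr0 scale1r; apply: submodZ.
have [q0|q0] := posnP (q v).
  by have := qA v; rewrite q0 expr0 scale1r; apply: submodZ.
apply: (IHN (fun w => q w - (w == v))%N) => [|w].
  move: qN; rewrite (bigD1 v) //= [X in _ -> (X <= _)%N](bigD1 v) //= eqxx.
  rewrite [X in _ -> (_ + X <= _)%N](eq_bigr q) => [|w /negPf ->]; last by rewrite subn0.
  by lia.
rewrite scalerA; case: eqP => [->|_].
  by rewrite -exprSr subn1 prednK.
by rewrite subn0 mulrC -scalerA; apply: submodZ.
Qed.

End ElementarySymmetric.

(** * Regular sequences in terms of ideal_mul *)

Section RegularSeq.
Variables (K : fieldType) (m : nat) (T : lmodType {mpoly K[m]}).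
Local Notation R := {mpoly K[m]}.
Implicit Types (s : seq R) (C A : T -> Prop).

Lemma ideal_mul_adds s z : @ideal_mul K m T s z <-> adds (fun=> True) s (fun y => y = 0) z.
Proof.
have H : forall s (A : T -> Prop) z, adds (fun=> True) s A z <->
    exists y w, [/\ @ideal_mul K m T s y, A w & z = y + w].
  elim=> [|f {}s IH] A {}z /=.
    split=> [Az|[y [w [[y' ->] Aw ->]]]]; last by rewrite big_ord0 add0r.
    by exists 0, z; rewrite add0r; split=> //; exists (fun=> 0); rewrite big_ord0.
  rewrite IH; split=> [[y [_ [[y' ->] [u [w [_ Aw ->]]] ->]]]|[_ [w [[y ->] Aw ->]]]].
    exists (f *: u + \sum_(j < size s) s`_j *: y' j), w; split=> //; last first.
      by rewrite addrCA addrA.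
    exists (fun j => if unlift ord0 j is Some j' then y' j' else u).
    rewrite big_ord_recl unlift_none; congr (_ + _); apply: eq_bigr => j _.
    by rewrite liftK.
  rewrite big_ord_recl; exists (\sum_(j < size s) s`_j *: y (lift ord0 j)), (f *: y ord0 + w).
  split; [by exists (fun j => y (lift ord0 j))|by exists (y ord0), w|].
  by rewrite addrA; congr (_ + _); rewrite addrC.
rewrite H; split=> [zs|[y [_ [ys -> ->]]]]; last by rewrite addr0.
by exists z, 0; rewrite addr0.
Qed.

Lemma reg_nth C s A : reg C s A <->
  forall j, (j < size s)%N -> nonzerodiv C s`_j (adds C (take j s) A).
Proof.
elim: s A => [|f s IH] A /=; first by [].
rewrite IH; split=> [[fA sA] [_|j]|sA]; [by []|exact: sA|].
by split=> [|j]; [apply: (sA 0%N)|apply: (sA j.+1)].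
Qed.

Lemma regular_seqP s : regular_seq T s <->
  reg (fun=> True) s (fun y : T => y = 0) /\
  exists x, ~ adds (fun=> True) s (fun y : T => y = 0) x.
Proof.
rewrite reg_nth; split=> -[sR [x xs]]; split.
- by move=> j js z _ /ideal_mul_adds/(sR j js)/ideal_mul_adds.
- by exists x => /ideal_mul_adds.
- by move=> j js z /ideal_mul_adds/(sR j js z I)/ideal_mul_adds.
- by exists x => /ideal_mul_adds.
Qed.

End RegularSeq.

(** * The primes generated by variables *)

Section FacePrime.
Variables (K : fieldType) (m : nat).
Local Notation R := {mpoly K[m]}.
Implicit Types (G F : {set 'I_m}) (p q : R).

(** Setting to zero the variables outside G; the kernel is the prime they generate. *)
Definition face_mor G p : R := p \mPo [tuple if i \in G then 'X_i else 0 | i < m].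

Definition face_prime G : {pred R} := fun p => face_mor G p == 0.

Lemma face_morE G p : face_mor G p =
  \sum_(u <- msupp p) p@_u *: \prod_i (if i \in G then 'X_i else 0) ^+ u i.
Proof.
rewrite /face_mor comp_mpolyEX; apply: eq_bigr => u _; congr (_ *: _).
by rewrite comp_mpolyX; apply: eq_bigr => i _; rewrite tnth_mktuple.
Qed.

Lemma face_morX G i : face_mor G 'X_i = if i \in G then 'X_i else 0.
Proof. by rewrite /face_mor comp_mpolyXU -tnth_nth tnth_mktuple. Qed.

Lemma face_prime_ideal G : idealr_closed (face_prime G) /\ prime_idealr_closed (face_prime G).
Proof.
split; first split.
- by rewrite unfold_in /face_mor rmorph0.
- by rewrite unfold_in /face_mor rmorph1 oner_eq0.
- move=> a p q; rewrite !unfold_in /face_mor rmorphD rmorphM /= => /eqP -> /eqP ->.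
  by rewrite mulr0 addr0.
by move=> p q; rewrite !unfold_in /face_mor rmorphM /= mulf_eq0.
Qed.

Lemma face_primeS G F : G \subset F -> {subset face_prime F <= face_prime G}.
Proof.
move=> GF p; rewrite !unfold_in => /eqP pF.
have -> : face_mor G p = face_mor G (face_mor F p).
  rewrite [face_mor F p]face_morE [LHS]face_morE [RHS]raddf_sum /=.
  apply: eq_bigr => u _; rewrite /face_mor linearZ /= rmorph_prod; congr (_ *: _).
  apply: eq_bigr => i _; rewrite rmorphXn /=; congr (_ ^+ _).
  case: (boolP (i \in F)) => iF; first by rewrite -[RHS]/(face_mor G 'X_i) face_morX.
  rewrite rmorph0; case: ifP => // iG.
  by rewrite (subsetP GF) in iF.
by rewrite pF /face_mor rmorph0.
Qed.

Lemma face_prime_mem G p :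
  (forall u, supp (deg_of_mnm u) \subset G -> p@_u = 0) -> p \in face_prime G.
Proof.
move=> pG; rewrite unfold_in face_morE big1 // => u _.
have [uG|/subsetPn[i]] := boolP (supp (deg_of_mnm u) \subset G).
  by rewrite pG // scale0r.
rewrite inE ffunE => ui iG; rewrite (bigD1 i) //= (negPf iG) expr0n.
by move: ui; case: (u i) => // k _; rewrite mul0r scaler0.
Qed.

End FacePrime.

(** * Dimension and bounds on depth *)

Section Dimension.
Variables (K : fieldType) (m n : nat) (T : lmodType {mpoly K[m]}) (S : sqmod n T).
Local Notation R := {mpoly K[m]}.
Local Notation x := (lvar K (emb S)).
Local Notation pr := (pr S).
Local Notation emb := (emb S).
Local Notation hdeg := (hdeg S).
Implicit Types (a : Zdeg n) (t u : T) (mu nu : 'X_{1..m}).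

Definition mon_deg (mu : 'X_{1..m}) : Zdeg n := \sum_j unit_deg (emb j) *+ mu j.

Lemma mon_degE mu j : mon_deg mu (emb j) = (mu j)%:Z.
Proof.
rewrite sum_ffunE (bigD1 j) //= big1 ?addr0 => [|i ij].
  by rewrite ffunMnE ffunE eqxx /= natz.
rewrite ffunMnE ffunE; case: eqP => [/(emb_inj (s := S)) ji|_]; last by rewrite mul0rn.
by rewrite ji eqxx in ij.
Qed.

Lemma hdeg_exp j k a t : hdeg a t -> hdeg (a + unit_deg (emb j) *+ k) ('X_j ^+ k *: t).
Proof.
move=> at_; elim: k => [|k IH]; first by rewrite mulr0n addr0 expr0 scale1r.
by rewrite mulrSr exprS -scalerA addrA -(varE S); apply: hom_var; rewrite (varE S).
Qed.

Lemma hdeg_mon mu a t : hdeg a t -> hdeg (a + mon_deg mu) ('X_[mu] *: t).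
Proof.
rewrite mpolyXE_id /mon_deg; move: a t.
apply: (big_rec2 (fun (q : R) (s : Zdeg n) => forall a t, hdeg a t -> hdeg (a + s) (q *: t))).
  by move=> a t; rewrite addr0 scale1r.
move=> j q s _ IH a t at_; rewrite -scalerA [_ *+ _ + _]addrC addrA.
by apply: hdeg_exp; apply: IH.
Qed.

Lemma exp_inj j k a t : 0 < a (emb j) -> hdeg a t -> 'X_j ^+ k *: t = 0 -> t = 0.
Proof.
move=> aj; elim: k a t aj => [|k IH] a t aj at_; first by rewrite expr0 scale1r.
rewrite exprSr -scalerA => /(IH (a + unit_deg (emb j))) E; apply: (var_inj aj at_).
rewrite (varE S); apply: E; last by rewrite -(varE S); apply: hom_var.
by rewrite !ffunE eqxx /=; lia.
Qed.

Lemma mon_inj mu a t : (forall j, mu j != 0%N -> 0 < a (emb j)) -> hdeg a t ->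
  'X_[mu] *: t = 0 -> t = 0.
Proof.
rewrite mpolyXE_id; move: a t.
apply: (big_rec (fun q : R => forall a t, (forall j, mu j != 0%N -> 0 < a (emb j)) ->
  hdeg a t -> q *: t = 0 -> t = 0)); first by move=> a t _ _; rewrite scale1r.
move=> i q _ IH a t aP at_; rewrite mulrC -scalerA => /(IH (a + unit_deg (emb i) *+ mu i)) E.
have [mi|mi] := eqVneq (mu i) 0%N.
  by move: E; rewrite mi mulr0n addr0 expr0 scale1r; apply.
apply: (exp_inj (k := mu i) (aP i mi) at_); apply: E; last exact: hdeg_exp.
move=> j /aP aj; rewrite ffunE ffunMnE ffunE; apply: ltr_wpDr => //.
exact: mulrn_wge0.
Qed.

Lemma mon_supp mu t : in_deg S (fun a => forall j, mu j != 0%N -> emb j \in supp a) ('X_[mu] *: t).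
Proof.
move=> a /existsNP[j /not_implyP[mj /negP aj]].
have -> : 'X_[mu] *: t = x (emb j) *: ('X_[(mu - U_(j))%MM] *: t).
  by rewrite (varE S) scalerA -mpolyXD addmC submK // lep1mP.
have := @in_deg_var _ _ _ _ S (fun=> True) (fun a => emb j \in supp a) (emb j)
  ('X_[(mu - U_(j))%MM] *: t).
apply=> //; last exact/negP.
by move=> b b0 _; rewrite supp_unitD // setU11.
Qed.

(** Multiplication by monomials is bijective from the squarefree degree with the same
    support as a onto the degree a. *)
Lemma set_deg_zero a y : hdeg a y ->
  (forall t, hdeg (set_deg (supp a)) t -> t = 0) -> y = 0.
Proof.
move=> ah aE; have [->//|/eqP y0] := eqVneq y 0; have a0 := hom_nneg ah y0.
have [N aN] : exists N : nat, tdeg a <= N%:Z by exists `|tdeg a|%N; lia.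
elim: N a y aN ah a0 aE {y0} => [|N IH] a y aN ah a0 aE.
  have -> : y = 0; last by [].
  apply: aE; rewrite (_ : set_deg _ = a) //; apply/ffunP => v; rewrite !ffunE inE.
  have : a v = 0; last by move=> ->.
  apply/eqP; rewrite eq_le a0 andbT; apply: le_trans aN.
  by rewrite /tdeg (bigD1 v) //= lerDl sumr_ge0.
have [/existsP[v av]|/existsPn an] := boolP [exists v, 1 < a v]; last first.
  apply: aE; rewrite (_ : set_deg _ = a) //; apply/ffunP => v; rewrite !ffunE inE.
  by have := an v; have := a0 v; case: (eqVneq (a v) 0) => /=; lia.
have [||y' yh' ->] := @var_surj _ _ _ _ S (a - unit_deg v) v y.
- by rewrite !ffunE eqxx /=; lia.
- by rewrite subrK.
have sE : supp (a - unit_deg v) = supp a.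
  apply/setP => w; rewrite !inE !ffunE.
  by case: (eqVneq w v) => [->|_]; rewrite ?subr0 //=; lia.
rewrite (IH _ _ _ yh') ?scaler0 //.
- by have := tdeg_unit (a - unit_deg v) v; rewrite subrK; lia.
- by move=> w; have := a0 w; rewrite !ffunE; case: (eqVneq w v) => [->|_] /=; lia.
- by move=> t; rewrite sE; apply: aE.
Qed.

Lemma mon_kill k : (forall F : {set 'I_n}, (k <= #|F|)%N -> forall t, hdeg (set_deg F) t -> t = 0) ->
  forall mu : 'X_{1..m}, (k <= #|supp (deg_of_mnm mu)|)%N -> forall t, 'X_[mu] *: t = 0.
Proof.
move=> TF mu muk t; apply: (@pr_ext _ _ _ _ S) => a.
have [muP|/mon_supp//] := pselect (forall j, mu j != 0%N -> emb j \in supp a).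
apply: (set_deg_zero (hom_pr S a _)) => u; apply: TF; apply: leq_trans muk _.
rewrite -(card_imset _ (@emb_inj _ _ _ _ S)); apply/subset_leq_card/subsetP => v /imsetP[j].
by rewrite inE ffunE => mj ->; apply: muP.
Qed.

Lemma annihilator_ideal : ideal (@annihilator K m T).
Proof.
split=> [t|r f g Tf Tg t]; first by rewrite scale0r.
by rewrite scalerDl -scalerA Tf Tg scaler0 addr0.
Qed.

(** The annihilator contains the monomials with support of size at least k, so k elements
    collapse modulo the annihilator. *)
Lemma regular_seq_size k s :
  (forall F : {set 'I_n}, (k <= #|F|)%N -> forall t, hdeg (set_deg F) t -> t = 0) ->
  regular_seq T s -> (size s < k)%N.
Proof.
move=> TF /regular_seqP[sR [y ys]]; rewrite ltnNge; apply/negP => ks; apply: ys.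
have [zs ts] := (submod_zero T, submodT T).
rewrite -(cat_take_drop k s) adds_cat; apply: addsW => //.
apply: (collapses_reg (J := @annihilator K m T)) => //.
- by have [] := (reg_cat (fun=> True) (take k s) (drop k s) (fun y : T => y = 0)).1; rewrite ?cat_take_drop.
apply: collapses_few_support; first exact: annihilator_ideal.
by move=> mu; rewrite size_takel // => /(mon_kill TF) muT z; apply: muT.
Qed.

(** A variable that acts by zero cannot act injectively on a nonzero component. *)
Lemma emb_of_face (F : {set 'I_n}) t v : hdeg (set_deg F) t -> t <> 0 -> v \in F ->
  exists j, emb j = v.
Proof.
move=> Ft t0 vF; apply: contrapT => /forallNP vj; apply: t0.
apply: (@var_inj _ _ _ _ S (set_deg F) v t) => //; first by rewrite ffunE vF.
by rewrite lvar_out ?scale0r // => j; apply/eqP/vj.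
Qed.

(** The lower bound comes from the primes generated by the variables outside the final
    segments of F: they contain the annihilator because the monomials in the variables of
    F map t to nonzero elements of distinct degrees. *)
Lemma sq_has_dim k (F : {set 'I_n}) t : hdeg (set_deg F) t -> t <> 0 -> #|F| = k ->
  (forall G : {set 'I_n}, (k < #|G|)%N -> forall t, hdeg (set_deg G) t -> t = 0) ->
  has_dim T k.
Proof.
move=> Ft t0 Fk TG; split; last first.
  move=> N P [Pp Ps]; rewrite leqNgt; apply/negP => kN.
  have /choice[f fP] j : exists f, (j < N)%N -> f \in P j.+1 /\ f \notin P j.
    have [jN|] := ltnP j N; last by exists 0.
    have [_ /existsNP[f /not_implyP[f1 /negP f0]]] := Ps j jN.
    by exists f.
  apply: (@collapses_prime _ (@annihilator K m T) (mkseq f k.+1) P).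
  - by move=> g; have [_ _] := Pp 0%N isT; apply.
  - rewrite size_mkseq => j jk; have jN : (j <= N)%N by exact: leq_trans jk kN.
    by have [] := Pp j jN.
  - rewrite size_mkseq => j jk; have jN : (j < N)%N by exact: leq_trans jk kN.
    rewrite nth_mkseq //; have [? ?] := fP j jN; split=> //.
    by have [] := Ps j jN.
  apply: collapses_few_support; first exact: annihilator_ideal.
  move=> mu; rewrite size_mkseq => muk z.
  exact: (mon_kill TG muk).
pose F' := [set j | emb j \in F].
have F'k : size (enum F') = k.
  rewrite -cardE -Fk -(card_imset _ (@emb_inj _ _ _ _ S)); congr (#|pred_of_set _|).
  apply/setP => v; apply/imsetP/idP => [[j]|vF]; first by rewrite inE => jF ->.
  have [j jv] := emb_of_face Ft t0 vF.
  by exists j; rewrite // inE jv.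
(* Dropping the elements of F' one by one makes the prime grow. *)
pose G j := [set i in drop j (enum F')].
have GF j : G j \subset F'.
  by apply/subsetP => i; rewrite inE => /mem_drop; rewrite mem_enum.
exists (fun j => face_prime (K := K) (G j)); split=> j jk.
  have [idl prm] := face_prime_ideal K (G j); split=> // p pT.
  apply: face_prime_mem => mu muG; apply: contrapT => /eqP pmu.
  have : 'X_[mu] *: t = 0.
    have := congr1 (pr (set_deg F + mon_deg mu)) (pT t).
    rewrite {1}[p]mpolyE scaler_suml pr_bigsum pr0 (bigD1_seq mu) ?msupp_uniq ?mcoeff_msupp //=.
    rewrite big1 ?addr0 => [|nu numu].
      rewrite -mul_mpolyC -scalerA prZ (hdeg_mon mu Ft) => E.
      by rewrite -[LHS]scale1r -mpolyC1 -(mulVf pmu) mpolyCM -[LHS]scalerA E scaler0.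
    rewrite -mul_mpolyC -scalerA prZ (pr_hom _ (hdeg_mon nu Ft)).
    case: eqP => [/addrI E|_]; last by rewrite scaler0.
    case/eqP: numu; apply/mnmP => i; apply/eqP; rewrite -eqz_nat -!mon_degE.
    by rewrite E.
  move=> /mon_inj muz; apply: t0; apply: muz Ft => i mi.
  have : i \in F'.
    apply: (subsetP (GF j)); apply: (subsetP muG).
    by rewrite inE ffunE.
  by rewrite inE ffunE => ->.
have GS : G j.+1 \subset G j.
  by apply/subsetP => i; rewrite !inE -add1n -drop_drop => /mem_drop.
split; first exact: face_primeS.
have jF : (j < size (enum F'))%N by rewrite F'k.
have /card_gt0P[i0 _] : (0 < #|'I_m|)%N.
  apply: leq_ltn_trans (leq0n j) _; apply: leq_trans jF _.
  by rewrite -cardE max_card.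
pose i := nth i0 (enum F') j.
have dE : drop j (enum F') = i :: drop j.+1 (enum F') by rewrite (drop_nth i0).
have iG : i \in G j by rewrite inE dE mem_head.
have iG' : i \notin G j.+1.
  have : uniq (drop j (enum F')) by rewrite drop_uniq // enum_uniq.
  by rewrite dE inE /= => /andP[].
move=> /(_ 'X_i); rewrite !unfold_in !face_morX (negPf iG') iG eqxx => /(_ isT)/eqP E.
by have := congr1 (mcoeff U_(i)%MM) E; rewrite mcoeffX mcoeff0 eqxx => /eqP; rewrite oner_eq0.
Qed.

End Dimension.

From mathcomp Require Import classical_sets functions.

(** * Homogeneous components in a graded module *)

Section GradedProjections.
Variables (K : fieldType) (n : nat) (M : gradedModule K n).
Implicit Types (a : Zdeg n) (x y : M).
Local Notation span := (span_of (component M)).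

Definition off a : set (Zdeg n) := fun b => b <> a.

Lemma componentD a x y : component M a x -> component M a y -> component M a (x + y).
Proof. by move=> ax ay; rewrite -[x]scale1r -mpolyC1; apply: componentP. Qed.

Lemma gpr_ex a x : exists y, component M a y /\ span (off a) (x - y).
Proof.
move: x (@component_sum _ _ M x); apply: span_ind.
- by exists 0; rewrite subr0; split; [exact: component0|exact: span0].
- move=> x y [x' [ax x'P]] [y' [ay y'P]]; exists (x' + y').
  by split; [exact: componentD|rewrite opprD addrACA; exact: spanD].
move=> b x _ bx; have [->|/eqP ba] := eqVneq a b.
  by exists x; rewrite subrr; split=> //; exact: span0.
exists 0; rewrite subr0; split; first exact: component0.
by apply: span_component bx => E; apply: ba.
Qed.

Definition gpr a x : M := projT1 (cid (gpr_ex a x)).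

Lemma gprP a x : component M a (gpr a x) /\ span (off a) (x - gpr a x).
Proof. by rewrite /gpr; case: cid. Qed.

Lemma gpr_unique a x y : component M a y -> span (off a) (x - y) -> gpr a x = y.
Proof.
move=> ay xy; have [az xz] := gprP a x; set z := gpr a x in az xz *.
apply/eqP; rewrite -subr_eq0; apply/eqP.
(* The difference has degree a and is a sum of elements of other degrees. *)
pose f b := if b == a then z - y else 0.
have fa : f a = z - y by rewrite /f eqxx.
rewrite -fa; apply: (span_outside (D := off a) (s := [:: a])) => //.
- by move=> b; rewrite /f; case: eqP => [->|_]; [exact: componentB|exact: component0].
- rewrite big_seq1 fa; have -> : z - y = (x - y) - (x - z).
    by rewrite opprB [RHS]addrC addrA subrK.
  by apply: spanD => //; apply: spanN.
- exact: mem_head.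
Qed.

Lemma gpr_component a x : component M a x -> gpr a x = x.
Proof. by move=> ax; apply: gpr_unique; rewrite // subrr; apply: span0. Qed.

Lemma gpr_off a b x : component M b x -> b <> a -> gpr a x = 0.
Proof.
move=> bx ba; apply: gpr_unique; first exact: component0.
by rewrite subr0; apply: span_component bx.
Qed.

Lemma gprD a x y : gpr a (x + y) = gpr a x + gpr a y.
Proof.
have [ax xP] := gprP a x; have [ay yP] := gprP a y.
by apply: gpr_unique; [exact: componentD|rewrite opprD addrACA; exact: spanD].
Qed.

Lemma spanC D (c : K) x : span D x -> span D (c%:MP *: x).
Proof.
move: x; apply: span_ind.
- by rewrite scaler0; apply: span0.
- by move=> x y Dx Dy; rewrite scalerDr; apply: spanD.
- by move=> b x Db /(componentZ c); apply: span_component.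
Qed.

Lemma gprZ a (c : K) x : gpr a (c%:MP *: x) = c%:MP *: gpr a x.
Proof.
have [ax xP] := gprP a x.
by apply: gpr_unique; [exact: componentZ|rewrite -scalerBr; exact: spanC].
Qed.

Lemma gpr_gpr a b x : gpr a (gpr b x) = if a == b then gpr b x else 0.
Proof.
have [bx _] := gprP b x; case: eqP => [->|ab]; first exact: gpr_component.
by apply: gpr_off bx _ => E; apply: ab.
Qed.

Lemma gpr_fin x : exists2 s, uniq s & x = \sum_(a <- s) gpr a x.
Proof.
suff [s sP] : exists s : seq (Zdeg n), forall L : seq (Zdeg n), uniq L -> {subset s <= L} ->
    x = \sum_(a <- L) gpr a x.
  exists (undup s); first exact: undup_uniq.
  by apply: sP; [exact: undup_uniq|move=> a; rewrite mem_undup].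
move: x (@component_sum _ _ M x); apply: span_ind.
- exists [::] => L _ _; rewrite big1 // => a _; apply: gpr_component.
  exact: component0.
- move=> x y [s sP] [t tP]; exists (s ++ t) => L uL stL.
  rewrite (eq_bigr (fun a => gpr a x + gpr a y)) => [|a _]; last exact: gprD.
  rewrite big_split /= -sP // -?tP // => a at_; apply: stL; rewrite mem_cat at_ ?orbT //.
move=> b x _ bx; exists [:: b] => L uL bL.
rewrite (bigD1_seq b) ?bL ?mem_head //= gpr_component // big1 ?addr0 // => a ab.
by apply: gpr_off bx _ => E; rewrite E eqxx in ab.
Qed.

Lemma gpr_var a v x : gpr (a + unit_deg v) ('X_v *: x) = 'X_v *: gpr a x.
Proof.
have [ax xP] := gprP a x; rewrite unit_degE.
apply: gpr_unique; first exact: component_mul.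
rewrite -scalerBr; move: (x - _) xP; apply: span_ind.
- by rewrite scaler0; apply: span0.
- by move=> y z Dy Dz; rewrite scalerDr; apply: spanD.
move=> b y ba bY; apply: (span_component (a := b + deg_of_mnm U_(v)%MM)).
  by move=> /addIr.
exact: component_mul.
Qed.

Lemma gpr_in a x : gpr a x = x -> component M a x.
Proof. by move=> <-; case: (gprP a x). Qed.

Lemma gpr_span D a x : span D x -> ~ D a -> gpr a x = 0.
Proof.
move=> + Da; move: x; apply: span_ind.
- exact/gpr_component/component0.
- by move=> x y x0 y0; rewrite gprD x0 y0 addr0.
by move=> b x Db bx; apply: gpr_off bx _ => E; rewrite E in Db.
Qed.

End GradedProjections.

(** * Squarefree graded modules *)

Section SquarefreeInstance.
Variables (K : fieldType) (n : nat) (M : gradedModule K n) (sfM : squarefree M).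
Implicit Types (a : Zdeg n) (x y : M).

Lemma gpr_ge0 a x : gpr a x <> 0 -> nneg_deg a.
Proof.
move=> ax; apply: contrapT => a0; apply: ax.
by case: sfM => _ /(_ x) xN _; apply: gpr_span xN _.
Qed.

Lemma lvar_id (v : 'I_n) : lvar K id v = 'X_v.
Proof. by rewrite -[v in lvar _ _ v]/(id v) lvar_emb. Qed.

Lemma gpr_lvar a v x :
  gpr (a + unit_deg v) (lvar K id v *: x) = lvar K id v *: gpr a x.
Proof. by rewrite lvar_id gpr_var. Qed.

Lemma sf_bij a v : nneg_deg a -> 0 < a v ->
  set_bij (component M a) (component M (a + unit_deg v)) (fun y => 'X_v *: y).
Proof.
move=> a0 av; pose mu : 'X_{1..n} := [multinom `|a i|%N | i < n].
have aE : a = deg_of_mnm mu.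
  by apply/ffunP => i; rewrite ffunE mnmE gez0_abs.
have -> : a + unit_deg v = deg_of_mnm (mu + U_(v))%MM.
  by rewrite aE unit_degE; apply/ffunP => i; rewrite !ffunE mnmDE PoszD.
rewrite aE; case: sfM => _ _; apply; apply/fintype.subsetP => i.
rewrite !inE !ffunE mnm1E; case: (eqVneq v i) => [<- _|//].
by move: av; rewrite aE ffunE lt0r => /andP[].
Qed.

Lemma gpr_inj a v x : 0 < a v -> gpr a x = x -> lvar K id v *: x = 0 -> x = 0.
Proof.
rewrite lvar_id => av ax xv; apply: contrapT => x0.
have a0 : nneg_deg a by apply: (@gpr_ge0 a x); rewrite ax.
have [_ inj _] := sf_bij a0 av; apply: x0; apply: inj => /=.
- exact/mem_set/gpr_in.
- exact/mem_set/component0.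
by rewrite xv scaler0.
Qed.

Lemma gpr_surj a v x : 0 < a v -> gpr (a + unit_deg v) x = x ->
  exists2 y, gpr a y = y & x = lvar K id v *: y.
Proof.
rewrite lvar_id => av ax; have [->|/eqP x0] := eqVneq x 0.
  by exists 0; rewrite ?scaler0 //; apply/gpr_component/component0.
have a0 : nneg_deg a.
  move=> i; have /(_ i) : nneg_deg (a + unit_deg v) by apply: (@gpr_ge0 _ x); rewrite ax.
  rewrite !ffunE; case: eqP => [->|_]; last by rewrite addr0.
  by move=> _; apply: ltW.
have [_ _ /(_ x (gpr_in ax))[y ay <-]] := sf_bij a0 av.
by exists y => //; apply: gpr_component.
Qed.

Definition graded_sqmod : sqmod n M :=
  @Sqmod K n n M id (@inj_id _) (@gpr _ _ M) (@gprD _ _ M) (@gprZ _ _ M) (@gpr_gpr _ _ M)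
    (@gpr_fin _ _ M) gpr_ge0 gpr_lvar gpr_inj gpr_surj.

Lemma hdeg_component a x : hdeg graded_sqmod a x <-> component M a x.
Proof. by split; [exact: gpr_in|exact: gpr_component]. Qed.

End SquarefreeInstance.

(** * Restrictions of squarefree modules *)

Section RestrictionInstance.
Variables (K : fieldType) (n : nat) (M : gradedModule K n) (sfM : squarefree M).
Variable V : {set 'I_n}.
Local Notation T := (restr M V).
Local Notation val := (@restr_val K n M V).
Local Notation emb := (@enum_val _ (mem V)).
Implicit Types (a : Zdeg n) (t u : T).

Lemma restr_span t : span_of (component M) (restr_deg V) (val t).
Proof. by have := restr_valP t; rewrite unfold_in => /asboolP. Qed.

Lemma rpr_subproof a t : gpr a (val t) \in @restr_pred K n M V.
Proof.
rewrite unfold_in; apply/asboolP; have [Da|Da] := pselect (restr_deg V a).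
  by apply: span_component Da _; case: (gprP a (val t)).
by rewrite (gpr_span (restr_span t) Da); apply: span0.
Qed.

Definition rpr a t : T := Restr (rpr_subproof a t).

Lemma val_rpr a t : val (rpr a t) = gpr a (val t). Proof. by []. Qed.

Lemma val0 : val 0 = 0. Proof. exact: (raddf0 (\val : T -> M)). Qed.
Lemma valD t u : val (t + u) = val t + val u. Proof. exact: (raddfD (\val : T -> M)). Qed.
Lemma val_inj_restr t u : val t = val u -> t = u. Proof. exact: val_inj. Qed.
Lemma val_scale p t : val (p *: t) = mpoly_incl p *: val t. Proof. by []. Qed.

Lemma incl_lvar v : mpoly_incl (lvar K emb v) = if v \in V then 'X_v else 0.
Proof.
case: ifPn => vV; last first.
  rewrite lvar_out ?/mpoly_incl ?rmorph0 // => j; apply: contraNneq vV => <-.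
  exact: enum_valP.
have -> : v = emb (enum_rank_in vV v) by rewrite enum_rankK_in.
rewrite lvar_emb; last exact: enum_val_inj.
by rewrite /mpoly_incl comp_mpolyXU -tnth_nth tnth_mktuple.
Qed.

Lemma val_lvar v t : v \in V -> val (lvar K emb v *: t) = 'X_v *: val t.
Proof. by move=> vV; rewrite val_scale incl_lvar vV. Qed.

Lemma rprD a t u : rpr a (t + u) = rpr a t + rpr a u.
Proof. by apply: val_inj_restr; rewrite valD !val_rpr valD gprD. Qed.

Lemma rprZ a (c : K) t : rpr a (c%:MP *: t) = c%:MP *: rpr a t.
Proof.
by apply: val_inj_restr; rewrite val_rpr !val_scale val_rpr /mpoly_incl comp_mpolyC gprZ.
Qed.

Lemma rpr_rpr a b t : rpr a (rpr b t) = if a == b then rpr b t else 0.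
Proof. by apply: val_inj_restr; rewrite !val_rpr gpr_gpr; case: eqP; rewrite ?val0. Qed.

Lemma rpr_fin t : exists2 s, uniq s & t = \sum_(a <- s) rpr a t.
Proof.
have [s us tE] := gpr_fin (val t); exists s => //; apply: val_inj_restr.
rewrite [LHS]tE; symmetry; exact: (raddf_sum (\val : T -> M)).
Qed.

Lemma rpr_ge0 a t : rpr a t <> 0 -> nneg_deg a.
Proof.
move=> at0; apply: (gpr_ge0 sfM (x := val t)) => E; apply: at0.
by apply: val_inj_restr; rewrite val0.
Qed.

Lemma rpr_var a v t : rpr (a + unit_deg v) (lvar K emb v *: t) = lvar K emb v *: rpr a t.
Proof.
apply: val_inj_restr; rewrite val_rpr !val_scale val_rpr incl_lvar; case: ifP => vV.
  exact: gpr_var.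
by rewrite !scale0r; apply/gpr_component/component0.
Qed.

Lemma rpr_out a v t : v \notin V -> 0 < a v -> rpr a t = 0.
Proof.
move=> vV av; apply: val_inj_restr; rewrite val0; apply: gpr_span (restr_span t) _.
move=> [_ /fintype.subsetP/(_ v)]; rewrite inE (negPf vV).
by move=> H; have : false by apply: H; have := av; lia.
Qed.

Lemma rpr_inj a v t : 0 < a v -> rpr a t = t -> lvar K emb v *: t = 0 -> t = 0.
Proof.
move=> av at_; have [vV|vV] := boolP (v \in V); last by rewrite -at_ (rpr_out _ vV).
move=> vt; apply: val_inj_restr; rewrite val0.
apply: (gpr_inj sfM av); first by rewrite -[in RHS]at_.
by rewrite lvar_id -val_lvar // vt val0.
Qed.

Lemma rpr_surj a v t : 0 < a v -> rpr (a + unit_deg v) t = t ->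
  exists2 u, rpr a u = u & t = lvar K emb v *: u.
Proof.
move=> av at_; have [vV|vV] := boolP (v \in V); last first.
  exists 0; last by rewrite scaler0 -at_ (rpr_out _ vV) // !ffunE eqxx /=; lia.
  by apply: val_inj_restr; rewrite val_rpr val0; apply/gpr_component/component0.
have [|y ay yE] := gpr_surj sfM av (x := val t); first by rewrite -[in RHS]at_.
rewrite lvar_id in yE; have [->|/eqP t0] := eqVneq t 0.
  exists 0; last by rewrite scaler0.
  by apply: val_inj_restr; rewrite val_rpr val0; apply/gpr_component/component0.
have yV : y \in @restr_pred K n M V.
  rewrite unfold_in; apply/asboolP.
  have Dav : restr_deg V (a + unit_deg v).
    apply: contrapT => Dav; apply: t0; rewrite -at_; apply: val_inj_restr.
    by rewrite val0; apply: gpr_span (restr_span t) Dav.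
  have a0 : nneg_deg a.
    move=> i; have [/(_ i) + _] := Dav.
    rewrite !ffunE; case: eqP => [->|_]; last by rewrite addr0.
    by move=> _; apply: ltW.
  apply: (span_component (a := a)); last exact: gpr_in.
  split=> //; have [_] := Dav; rewrite supp_unitD //; apply: fintype.subset_trans.
  exact: finset.subsetUr.
exists (Restr yV); first by apply: val_inj_restr.
by apply: val_inj_restr; rewrite val_lvar.
Qed.

Definition restr_sqmod : sqmod n T :=
  @Sqmod K #|V| n T emb (@enum_val_inj _ _) rpr rprD rprZ rpr_rpr rpr_fin rpr_ge0
    rpr_var rpr_inj rpr_surj.

Lemma hdeg_restr a t : hdeg restr_sqmod a t <-> component M a (val t).
Proof.
split=> [at_|at_].
  by apply: gpr_in; rewrite -[in RHS]at_.
by apply: val_inj_restr; apply: gpr_component.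
Qed.

End RestrictionInstance.

(** * Exactness for a restriction *)

Section RestrictionTransfer.
Variables (K : fieldType) (n : nat) (M : gradedModule K n) (sfM : squarefree M).
Variable V : {set 'I_n}.
Local Notation T := (restr M V).
Local Notation val := (@restr_val K n M V).
Local Notation emb := (@enum_val _ (mem V)).
Implicit Types (A H : {set 'I_n}).

Lemma val_sum (I : Type) (r : seq I) (P : pred I) (F : I -> T) :
  val (\sum_(i <- r | P i) F i) = \sum_(i <- r | P i) val (F i).
Proof. exact: (raddf_sum (\val : T -> M)). Qed.

Lemma val_kdiff sg (C : {set 'I_n} -> T) H : H \subset V ->
  val (kdiff (lvar K emb) sg C H) = kdiff (lvar K id) sg (fun G => val (C G)) H.
Proof.
move=> HV; rewrite val_sum; apply: eq_bigr => v vH.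
have vV := fintype.subsetP HV v vH.
have vE t : val (lvar K emb v *: t) = lvar K id v *: val t by rewrite val_lvar // lvar_id.
rewrite -!scalerA; case: (sg v H); last by rewrite expr0 !scale1r vE.
by rewrite expr1 !scaleN1r -vE; exact: (raddfN (\val : T -> M)).
Qed.

Lemma kdiff_offV sg (C : {set 'I_n} -> T) H : ~~ (H \subset V) ->
  (forall G : {set 'I_n}, ~~ (G \subset V) -> C G = 0) -> kdiff (lvar K emb) sg C H = 0.
Proof.
move=> HV C0; rewrite /kdiff big1 // => v vH.
have [vV|vV] := boolP (v \in V); last first.
  rewrite lvar_out ?mulr0 ?scale0r // => j; apply: contraNneq vV => <-.
  exact: enum_valP.
rewrite C0 ?scaler0 //; apply: contra HV => /fintype.subsetP HV; apply/fintype.subsetP => w wH.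
by have [->//|wv] := eqVneq w v; apply: HV; rewrite !inE wv.
Qed.

Lemma subsetCUC A H : (H \subset ~: (A :|: ~: V)%SET) = (H \subset ~: A)%SET && (H \subset V).
Proof. by rewrite finset.setCU finset.setCK finset.subsetI. Qed.

(** The components of the restriction to V are those of M with support in V, so a
    complex indexed by sets disjoint from A and contained in V is the same for both. *)
Lemma exact_of_restr A j : exact_at (restr_sqmod sfM V) ksign A j ->
  exact_at (graded_sqmod sfM) ksign (A :|: ~: V)%SET j.
Proof.
move=> ex c cH cd.
pose ok H := (H \subset ~: (A :|: ~: V)%SET) && (#|H| == j).
have /choice[C CP] H : exists t : T, (ok H -> val t = c H) /\ (~~ ok H -> t = 0).
  case: (boolP (ok H)) => [okH|_]; last by exists 0.
  have /andP[HU /eqP Hj] := okH.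
  have cV : c H \in @restr_pred K n M V.
    rewrite unfold_in; apply/asboolP.
    apply: (span_component (a := set_deg H)); last by apply/hdeg_component/cH.
    split; first by move=> i; rewrite ffunE.
    by rewrite supp_set_deg; move: HU; rewrite subsetCUC => /andP[].
  by exists (Restr cV).
have C0 (G : {set 'I_n}) : ~~ (G \subset V) -> C G = 0.
  by move=> GV; apply: (CP G).2; rewrite /ok subsetCUC (negPf GV) andbF.
have [||B [BH BE]] := ex C.
- move=> H HA Hj; apply/hdeg_restr; have [HV|HV] := boolP (H \subset V).
    rewrite (CP H).1; last by rewrite /ok subsetCUC HA HV Hj eqxx.
    by apply/hdeg_component/cH; rewrite // subsetCUC HA.
  by rewrite C0 // val0; apply: component0.
- move=> H HA Hj; have [HV|HV] := boolP (H \subset V); last exact: kdiff_offV.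
  apply: val_inj_restr; rewrite val0 val_kdiff // -[RHS](cd H) //; last by rewrite subsetCUC HA.
  apply: kdiff_eq => v vH; apply: (CP _).1; rewrite /ok subsetCUC.
  rewrite !(fintype.subset_trans (finset.subD1set _ _)) //=.
  by have := finset.cardsD1 v H; rewrite vH Hj add1n => -[->].
exists (fun G => val (B G)); split=> H; rewrite subsetCUC => /andP[HA HV] Hj.
  by apply/hdeg_component/hdeg_restr; apply: BH.
rewrite -val_kdiff // -BE //; apply/esym/(CP H).1.
by rewrite /ok subsetCUC HA HV Hj eqxx.
Qed.

Lemma exact_to_restr A j : exact_at (graded_sqmod sfM) ksign (A :|: ~: V)%SET j ->
  exact_at (restr_sqmod sfM V) ksign A j.
Proof.
move=> ex C CH Cd.
have C0 H : H \subset (~: A)%SET -> #|H| = j -> ~~ (H \subset V) -> C H = 0.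
  move=> HA Hj /subsetPn[v vH vV]; rewrite -(CH H HA Hj).
  by apply: (rpr_out _ vV); rewrite ffunE vH.
have [||b [bH bE]] := ex (fun H => val (C H)).
- move=> H; rewrite subsetCUC => /andP[HA HV] Hj.
  by apply/hdeg_component/hdeg_restr; apply: CH.
- move=> H; rewrite subsetCUC => /andP[HA HV] Hj.
  by rewrite -val_kdiff // Cd // val0.
pose ok H := (H \subset ~: (A :|: ~: V)%SET) && (#|H|.+1 == j).
have /choice[B BP] H : exists t : T, (ok H -> val t = b H) /\ (~~ ok H -> t = 0).
  case: (boolP (ok H)) => [okH|_]; last by exists 0.
  have /andP[HU /eqP Hj] := okH.
  have bV : b H \in @restr_pred K n M V.
    rewrite unfold_in; apply/asboolP.
    apply: (span_component (a := set_deg H)); last by apply/hdeg_component/bH.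
    split; first by move=> i; rewrite ffunE.
    by rewrite supp_set_deg; move: HU; rewrite subsetCUC => /andP[].
  by exists (Restr bV).
have B0 (G : {set 'I_n}) : ~~ (G \subset V) -> B G = 0.
  by move=> GV; apply: (BP G).2; rewrite /ok subsetCUC (negPf GV) andbF.
exists B; split=> H HA Hj.
  apply/hdeg_restr; have [okH|okH] := boolP (ok H); last first.
    by rewrite (BP H).2 // val0; apply: component0.
  have /andP[HU _] := okH.
  by rewrite (BP H).1 //; apply/hdeg_component/bH.
have [HV|HV] := boolP (H \subset V); last by rewrite C0 // kdiff_offV.
apply: val_inj_restr; rewrite val_kdiff // bE ?subsetCUC ?HA //.
apply: kdiff_eq => v vH; apply/esym/(BP _).1; rewrite /ok subsetCUC.
rewrite !(fintype.subset_trans (finset.subD1set _ _)) //=.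
by have := finset.cardsD1 v H; rewrite vH Hj add1n => ->.
Qed.

End RestrictionTransfer.

(** * Exactness for a skeleton *)

Section SkeletonTransfer.
Variables (K : fieldType) (n : nat) (M : gradedModule K n) (i : nat).
Variables (sfM : squarefree M) (sfS : squarefree (skeleton M i)).
Implicit Types (U H : {set 'I_n}).

Local Notation proj := (fun x : M => \pi_(skel M i)%qT x : skeleton M i).

Lemma projZ (p : {mpoly K[n]}) x : proj (p *: x) = p *: proj x.
Proof. exact/esym/skel_scale_pi. Qed.

Lemma proj0 : proj 0 = 0.
Proof. exact: (raddf0 \pi_(skel M i)%qT). Qed.

Lemma proj_eq0 x : proj x = 0 -> span_of (component M) (above_deg i) x.
Proof.
move=> px; have : x \in @above K n M i; last by rewrite unfold_in => /asboolP.
rewrite -[x]subr0 Quotient.idealrBE; apply/eqP; rewrite [RHS]proj0; exact: px.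
Qed.

Lemma proj_above x : span_of (component M) (above_deg i) x -> proj x = 0.
Proof.
move=> xi; rewrite -proj0; apply/eqP.
by rewrite -[_ == _]Quotient.idealrBE subr0 unfold_in; apply/asboolP.
Qed.

Lemma proj_kdiff sg (c : {set 'I_n} -> M) H :
  proj (kdiff (lvar K id) sg c H) = kdiff (lvar K id) sg (fun G => proj (c G)) H.
Proof.
rewrite [LHS](raddf_sum \pi_(skel M i)%qT); apply: eq_bigr => v _; exact: projZ.
Qed.

Lemma skel_component_zero a (u : skeleton M i) :
  (i < #|supp a|)%N -> component (skeleton M i) a u -> u = 0.
Proof.
move=> ia au; have [->//|/eqP u0] := eqVneq u 0.
have a0 : nneg_deg a by apply: (hom_nneg (S := graded_sqmod sfS) _ u0); apply/hdeg_component.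
by case: au => y ay <-; apply: proj_above; apply: span_component ay.
Qed.

(** The terms of the complex in the positions j - 1, j and j + 1 are the same for M and
    for its skeleton, as j + 1 <= i. *)
Lemma exact_skeleton U j : (j < i)%N -> exact_at (graded_sqmod sfM) ksign U j ->
  exact_at (graded_sqmod sfS) ksign U j.
Proof.
move=> ji ex c cH cd.
have /choice[y yP] H : exists y, H \subset (~: U)%SET -> #|H| = j ->
    component M (set_deg H) y /\ proj y = c H.
  have [[HU Hj]|nH] := pselect (H \subset (~: U)%SET /\ #|H| = j).
    by have /hdeg_component[y ay yE] := cH H HU Hj; exists y.
  by exists 0 => HU Hj; case: nH.
have [||b [bH bE]] := ex y.
- by move=> H HU Hj; apply/hdeg_component; case: (yP H HU Hj).
- move=> H HU Hj.
  have HD v : v \in H -> (H :\ v)%SET \subset (~: U)%SET /\ #|(H :\ v)%SET| = j.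
    move=> vH; split; first exact: fintype.subset_trans (finset.subD1set _ _) HU.
    by have := finset.cardsD1 v H; rewrite vH Hj add1n => -[<-].
  have hH : hdeg (graded_sqmod sfM) (set_deg H) (kdiff (lvar K id) ksign y H).
    have := @hom_kdiff _ _ _ _ (graded_sqmod sfM) ksign y 0 H; rewrite add0r; apply.
    move=> v /HD[HU' Hj']; rewrite add0r; apply/hdeg_component.
    by case: (yP _ HU' Hj').
  have pH : proj (kdiff (lvar K id) ksign y H) = 0.
    rewrite proj_kdiff -(cd H HU Hj); apply: kdiff_eq => v /HD[HU' Hj'].
    by case: (yP _ HU' Hj').
  rewrite -hH; apply: gpr_span (proj_eq0 pH) _ => -[_].
  by rewrite supp_set_deg Hj; lia.
exists (fun G => proj (b G)); split=> H HU Hj.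
  by apply/hdeg_component; exists (b H) => //; apply/hdeg_component/bH.
by rewrite -proj_kdiff -bE //; case: (yP H HU Hj).
Qed.

End SkeletonTransfer.

(** * The Cohen-Macaulay criterion and the theorem *)

Section CMSq.
Variables (K : fieldType) (m n : nat) (T : lmodType {mpoly K[m]}) (S : sqmod n T).
Local Notation R := {mpoly K[m]}.
Local Notation x := (lvar K (emb S)).
Implicit Types (F H : {set 'I_n}).

(** Every monomial other than 1 is divisible by a variable. *)
Lemma irrelevant_span (f : R) : irrelevant f -> exists g : 'I_n -> R, f = \sum_v x v * g v.
Proof.
move=> /eqP f0; pose Q f := exists g : 'I_n -> R, f = \sum_v x v * g v.
have Q0 : Q 0 by exists (fun=> 0); rewrite big1 // => v _; rewrite mulr0.
have QD p q : Q p -> Q q -> Q (p + q).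
  move=> [g ->] [h ->]; exists (fun v => g v + h v); rewrite -big_split.
  by apply: eq_bigr => v _; rewrite mulrDr.
have QM p q : Q p -> Q (p * q).
  move=> [g ->]; exists (fun v => g v * q); rewrite mulr_suml.
  by apply: eq_bigr => v _; rewrite mulrA.
have QX j : Q 'X_j.
  exists (fun v => (v == emb S j)%:R); rewrite (bigD1 (emb S j)) //= eqxx mulr1 varE.
  by rewrite big1 ?addr0 // => v /negPf ->; rewrite mulr0.
rewrite -/(Q f) [f]mpolyE big_seq; apply: (big_ind Q) => // mu muf.
have [j mj] : exists j, mu j != 0%N.
  apply/existsP; apply: contraTT muf => /existsPn mu0.
  have -> : mu = 0%MM by apply/mnmP => j; rewrite mnm0E; apply/eqP; rewrite -[_ == _]negbK.
  by rewrite mcoeff_msupp f0 eqxx.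
have -> : 'X_[mu] = 'X_j * 'X_[(mu - U_(j))%MM] :> R.
  by rewrite -mpolyXD addmC submK // lep1mP.
by rewrite -mul_mpolyC mulrC; do 2![apply: (QM)].
Qed.

Lemma exact_of_regular k s : all (@irrelevant K m) s -> regular_seq T s -> size s = k ->
  forall (A : {set 'I_n}) j, (j + #|A| < k)%N -> exact_at S ksign A j.
Proof.
move=> /allP sirr /regular_seqP[sR _] sk A j; apply: kvanish_exact.
rewrite -sk; apply: reg_kvanish => //; first exact: submod_zero.
by move=> f /sirr; apply: irrelevant_span.
Qed.

Lemma adds_sub (C A A' : T -> Prop) (s : seq R) :
  (forall z, A z -> A' z) -> (forall y z, A' y -> A' z -> A' (y + z)) ->
  (forall f y, f \in s -> C y -> A' (f *: y)) -> forall z, adds C s A z -> A' z.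
Proof.
move=> + AD; elim: s A => //= f s IH A AA fA; apply: IH.
  move=> _ [y [w [Cy Aw ->]]]; apply: AD; last exact: AA.
  by apply: fA; rewrite ?mem_head.
by move=> g y gs; apply: fA; rewrite inE gs orbT.
Qed.

(** If T = (e_1, ..., e_k) T, the part of T of lowest total degree vanishes, as the e_j
    have positive degree. *)
Lemma elsyms_nakayama k :
  (forall t, adds (fun=> True) (elsyms S k) (fun y : T => y = 0) t) -> forall t : T, t = 0.
Proof.
move=> all t.
suff H N : forall (e : int) (t : T), e < N%:Z -> tpr S e t = 0.
  apply: (tpr_in (S := S) (submod_zero T)) => e.
  by apply: (H `|e|.+1); lia.
elim: N => [|N IH] e {}t eN; first exact: tpr_neg.
apply: (adds_sub (A' := fun u => tpr S e u = 0)) (all t).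
- by move=> z ->; apply: tpr0.
- by move=> y z yE zE; rewrite tprD yE zE addr0.
move=> f y /mapP[j]; rewrite mem_iota => /andP[j0 _] fE _; rewrite {}fE.
rewrite scaler_suml tpr_bigsum big1 // => F /eqP Fj.
rewrite -big_enum prod_tpr IH ?scaler0 // -cardE Fj; lia.
Qed.

Lemma elsyms_irrelevant k : all (@irrelevant K m) (elsyms S k).
Proof.
apply/allP => f /mapP[j]; rewrite mem_iota => /andP[j0 _] fE; rewrite {}fE.
rewrite /irrelevant /elsym raddf_sum big1 // => F /eqP Fj.
have /card_gt0P[v vF] : (0 < #|F|)%N by rewrite Fj.
rewrite (bigD1 v) //= rmorphM /= /lvar.
case: pickP => [i _|_]; last by rewrite mcoeff0 mul0r.
rewrite mcoeffX (_ : (_ == _) = false) ?mul0r //.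
by apply/negP => /eqP/(congr1 (fun mu : 'X_{1..m} => mu i)); rewrite mnm1E eqxx mnm0E.
Qed.

(** One half of the criterion.  Some component of support size k is nonzero, since
    otherwise the bound on depth would contradict the regular sequence of length k. *)
Lemma sq_CohenMacaulay k :
  (forall (A : {set 'I_n}) j, (j + #|A| < k)%N -> exact_at S ksign A j) ->
  (forall H : {set 'I_n}, (k < #|H|)%N -> forall t, hdeg S (set_deg H) t -> t = 0) ->
  ~ zero_module T ->
  [/\ has_dim T k, has_depth T k
    & exists (F : {set 'I_n}) t, [/\ hdeg S (set_deg F) t, t <> 0 & #|F| = k]].
Proof.
move=> ex TH Tn0.
have supp_gt0 : in_deg S (supp_gt k) = (fun t => t = 0).
  apply/funext => t; apply/propext; split=> [tk|-> a _]; last exact: pr0.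
  apply: (@pr_ext _ _ _ _ S) => a; have [ka|ka] := pselect (supp_gt k a); last exact: tk.
  by apply: (set_deg_zero (hom_pr S a t)) => u; apply: TH.
have sreg : regular_seq T (elsyms S k).
  apply/regular_seqP; split.
    rewrite -supp_gt0; apply: elsyms_reg => j jk; apply: exact_kvanish => A i iA.
    by apply: ex; apply: leq_trans jk.
  by apply: contrapT => /forallNP H; apply: Tn0; apply: (@elsyms_nakayama k) => t; apply: contrapT (H t).
have [F [t [Ft t0 Fk]]] : exists (F : {set 'I_n}) t, [/\ hdeg S (set_deg F) t, t <> 0 & #|F| = k].
  apply: contrapT => nF; suff : (size (elsyms S k) < k)%N by rewrite size_elsyms ltnn.
  apply: (@regular_seq_size _ _ _ _ S) sreg => F kF t Ft; apply: contrapT => t0; apply: nF.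
  exists F, t; split=> //; apply/eqP; rewrite eqn_leq kF andbT leqNgt.
  by apply/negP => kF'; apply: t0; apply: TH Ft.
split; last by exists F, t.
  exact: sq_has_dim Ft t0 Fk TH.
split; first by exists (elsyms S k); split; rewrite ?size_elsyms ?elsyms_irrelevant.
by move=> s _ sR; rewrite -ltnS; apply: (@regular_seq_size _ _ _ _ S) sR => H; apply: TH.
Qed.

End CMSq.

Lemma has_dim_unique (K : fieldType) n (M : lmodType {mpoly K[n]}) d e :
  has_dim M d -> has_dim M e -> d = e.
Proof.
move=> [[P Pd] dP] [[Q Qe] eQ]; apply/eqP; rewrite eqn_leq.
by rewrite (eQ _ _ Pd) (dP _ _ Qe).
Qed.

(** The other half of the criterion, applied to all the restrictions at once. *)
Lemma higher_CM_exact (K : fieldType) n (M : gradedModule K n) (sfM : squarefree M) d l :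
  has_dim M d -> higher_CohenMacaulay l M ->
  forall (W A : {set 'I_n}) j, (#|W| < l)%N -> (j + #|A| < d)%N ->
    exact_at (graded_sqmod sfM) ksign (A :|: W)%SET j.
Proof.
move=> Md CM W A j Wl jd; rewrite -[W]finset.setCK; apply: exact_of_restr.
case: (CM W Wl) => [N0|[[e [Ne [[s [sirr sreg sz]] _]]] [d' [Nd' Md']]]].
  move=> c _ _; exists (fun=> 0); split=> [H _ _|H _ _]; [exact: hom0|exact: etrans (N0 _) (esym (N0 _))].
apply: exact_of_regular sirr sreg sz _ _ _.
by rewrite (has_dim_unique Ne Nd') (has_dim_unique Md' Md).
Qed.

Lemma subset_card (T : finType) (B : {set T}) k : (k <= #|B|)%N ->
  exists2 A : {set T}, A \subset B & #|A| = k.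
Proof.
move=> kB; exists [set x in take k (enum B)].
  by apply/fintype.subsetP => x; rewrite inE => /mem_take; rewrite mem_enum.
rewrite cardsE (card_uniqP _) ?take_uniq ?enum_uniq // size_takel //.
by rewrite -cardE.
Qed.

Theorem theorem2p7 (K : fieldType) (n : nat) (M : gradedModule K n) (d i l : nat) :
  squarefree M -> has_dim M d -> (i < d)%N -> (0 < l)%N ->
  higher_CohenMacaulay l M ->
  ~ zero_module (skeleton M i) ->
  higher_CohenMacaulay (l + d - i) (skeleton M i).
Proof.
move=> sfM Md id_ l0 CM _ W Wl /=.
have sfS := skeleton_squarefree i sfM.
have [N0|Nn0] := pselect (zero_module (restr (skeleton M i) (~: W)%SET)); first by left.
right; set S := restr_sqmod sfS (~: W)%SET.
have SH (H : {set 'I_n}) : (i < #|H|)%N -> forall t, hdeg (graded_sqmod sfS) (set_deg H) t -> t = 0.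
  move=> iH t /hdeg_component; apply: (skel_component_zero sfS).
  by rewrite supp_set_deg.
have NH (H : {set 'I_n}) : (i < #|H|)%N -> forall t, hdeg S (set_deg H) t -> t = 0.
  move=> iH t /hdeg_restr Ht; apply: val_inj_restr; rewrite val0.
  by apply: (SH H iH); apply/hdeg_component.
have ex (A : {set 'I_n}) j : (j + #|A| < i)%N -> exact_at S ksign A j.
  move=> jA; apply: exact_to_restr; rewrite finset.setCK.
  apply: (exact_skeleton (sfM := sfM)); first by lia.
  (* As many elements as the hypothesis allows are put in W'; each remaining one costs a
     position of exactness. *)
  have [W' W'B W'c] := subset_card (geq_minr l.-1 #|(A :|: W)%SET|).
  have -> : (A :|: W)%SET = (((A :|: W) :\: W') :|: W')%SET.
    by rewrite [RHS]finset.setUC -[X in _ = (X :|: _)%SET](finset.setIidPr W'B) finset.setID.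
  apply: (higher_CM_exact Md CM); first by rewrite W'c; lia.
  rewrite finset.cardsD (finset.setIidPr W'B) W'c.
  have : (#|(A :|: W)%SET| <= #|A| + #|W|)%N by rewrite finset.cardsU leq_subr.
  by lia.
have [dimN depN [F [t [Ft t0 Fi]]]] := sq_CohenMacaulay ex NH Nn0.
split; first by exists i.
exists i; split=> //.
apply: (@sq_has_dim _ _ _ _ (graded_sqmod sfS) i F (restr_val t)) => //.
  by apply/hdeg_component/hdeg_restr.
by move=> tz; apply: t0; apply: val_inj_restr; rewrite val0.
Qed.
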